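(* Let $(X,d)$ and $(Y,\rho)$ be complete metric spaces, let $s>0$, and let $f\colon X\to Y$ be Lipschitz. Suppose $\mathcal{H}^s(X)<\infty$ and that for $\mathcal{H}^s$-almost every $x\in X$ there exists $0<\lambda_x\leq 1$ such that \[ \limsup_{r\to 0}\frac{\mathcal{H}^s\big(B(f(x),\lambda_x r)\setminus f(B(x,r))\big)}{(2\lambda_x r)^s} < \frac12\,\Theta^s_*(Y,f(x)). \] Then there exists a countable Borel decomposition $X=N\cup\bigcup_{i} X_i$ with $\mathcal{H}^s(N)=0$ such that for each $i$ the restriction $f|_{X_i}$ is bi-Lipschitz.
   Context: $\mathcal{H}^s$ denotes the $s$-dimensional Hausdorff (outer) measure on a metric space, and $B(z,r)$ denotes the ball of radius $r$ centred at $z$. For a subset $S$ of a metric space and a point $z$, the lower $s$-density is $\Theta^s_*(S,z):=\liminf_{r\to0}\frac{\mathcal{H}^s(B(z,r)\cap S)}{(2r)^s}$. A map $f$ is Lipschitz if $\rho(f(x),f(y))\leq L\,d(x,y)$ for some $L\ge 0$ and all $x,y$; an injective Lipschitz map is bi-Lipschitz if its inverse is also Lipschitz. *)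

(* Defs.v *)
From HB Require Import structures.
From mathcomp Require Import all_boot all_order all_algebra.
From mathcomp Require Import all_classical all_reals all_analysis.
Set Implicit Arguments. Unset Strict Implicit. Unset Printing Implicit Defensive.
Import Order.TTheory GRing.Theory Num.Theory.
Local Open Scope classical_set_scope.
Local Open Scope ring_scope.

Section MetricDefs.
Context {R : realType} {T : Type} (d : T -> T -> R).

Definition is_metric : Prop :=
  [/\ (forall x y, 0 <= d x y), (forall x y, d x y = 0 <-> x = y),
      (forall x y, d x y = d y x) & (forall x y z, d x z <= d x y + d y z)].

Definition dcauchy (u : nat -> T) : Prop :=
  forall e, 0 < e -> exists N, forall m n, (N <= m)%N -> (N <= n)%N -> d (u m) (u n) < e.

Definition dconverges (u : nat -> T) (x : T) : Prop :=
  forall e, 0 < e -> exists N, forall n, (N <= n)%N -> d (u n) x < e.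

Definition complete_metric : Prop :=
  forall u, dcauchy u -> exists x, dconverges u x.

Definition dball (x : T) (r : R) : set T := [set y | d x y < r].

Definition dopen (A : set T) : Prop :=
  forall x, A x -> exists r, 0 < r /\ dball x r `<=` A.

Definition dborel (A : set T) : Prop := <<s dopen >> A.

(* diameter (extended real; -oo for the empty set) *)
Definition diam (E : set T) : \bar R :=
  ereal_sup [set (d x y)%:E | x in E & y in E].

(* diam(E)^s, with diam(empty) ^ s = 0 (s > 0) *)
Definition hcost (s : R) (E : set T) : R := (fine (diam E)) `^ s.

Definition hausdorff_delta (s delta : R) (A : set T) : \bar R :=
  ereal_inf [set (\sum_(0 <= i <oo) ((hcost s (F i))%:E))%E | F in
    [set F : nat -> set T | A `<=` \bigcup_i F i /\
                            forall i, (diam (F i) <= delta%:E)%E]].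

(* s-dimensional Hausdorff (outer) measure H^s(A) = lim_{delta -> 0} H^s_delta(A) *)
Definition hausdorff (s : R) (A : set T) : \bar R :=
  ereal_sup [set hausdorff_delta s delta A | delta in [set e : R | 0 < e]].

End MetricDefs.

Section LimDefs.
Context {R : realType}.
Definition liminf0 (g : R -> \bar R) : \bar R :=
  ereal_sup [set ereal_inf [set g r | r in [set r : R | 0 < r < e]] | e in [set e : R | 0 < e]].
Definition limsup0 (g : R -> \bar R) : \bar R :=
  ereal_inf [set ereal_sup [set g r | r in [set r : R | 0 < r < e]] | e in [set e : R | 0 < e]].
End LimDefs.

Definition lower_density {R : realType} {T : Type} (d : T -> T -> R) (s : R)
  (S : set T) (z : T) : \bar R :=
  liminf0 (fun r => (hausdorff d s (dball d z r `&` S) * ((2 * r) `^ s)^-1%:E)%E).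

Definition lipschitz_map {R : realType} {X Y : Type} (d : X -> X -> R) (rho : Y -> Y -> R)
  (f : X -> Y) : Prop :=
  exists L : R, 0 <= L /\ forall x y, rho (f x) (f y) <= L * d x y.

Definition bilipschitz_on {R : realType} {X Y : Type} (d : X -> X -> R) (rho : Y -> Y -> R)
  (f : X -> Y) (A : set X) : Prop :=
  {in A &, injective f} /\
  exists L : R, 0 <= L /\ forall x y, A x -> A y ->
    rho (f x) (f y) <= L * d x y /\ d x y <= L * rho (f x) (f y).

(* Main.v *)
Require Import Defs.
From HB Require Import structures.
From mathcomp Require Import all_boot all_order all_algebra.
From mathcomp Require Import all_classical all_reals all_analysis.
From mathcomp Require Import ring lra.
Import Order.TTheory GRing.Theory Num.Theory.
Set Implicit Arguments. Unset Strict Implicit. Unset Printing Implicit Defensive.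
Local Open Scope classical_set_scope.
Local Open Scope ring_scope.

(**
  Let [x, x'] be points at distance [2r] with [f x, f x'] much closer than [r].
  By the density hypothesis the images of the disjoint balls [B(x,r)] and
  [B(x',r)] each miss less than half of a ball around [f x], so they overlap in
  measure at least [kappa r^s]: the points are "colliding" at scale [r].  It
  suffices to show that the set of points colliding at arbitrarily small scales
  is null; off this set [f] is bi-Lipschitz on countably many pieces, and the
  closures of these pieces are Borel.

  By completeness, [X] is exhausted up to small measure by a compact [K].
  Fibres of [f] over [K] are infinite only over a null subset of [Y]; off that
  subset, the points of [K] whose fibre contains two distinct points of [K] at
  distance [<= 1/n] form measurable sets decreasing to the empty set.  Covering the
  colliding points by the 5r-covering lemma, every ball of the disjoint family
  pays [kappa r^s] out of one of these sets or out of the complement of [K], so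
  the sum of the [r^s] tends to zero with the scale.
*)

(** * Hausdorff outer measure *)

(** Both sides are the sum of one nonnegative family over [nat * nat]. The bijection is returned so
    that the same enumeration also flattens a doubly indexed cover. *)
Lemma nneseries_pair (R : realType) (c : nat -> nat -> \bar R) :
  (forall i j, 0 <= c i j)%E ->
  exists f : nat -> nat * nat, set_bij setT setT f /\
  (\sum_(0 <= i <oo) \sum_(0 <= j <oo) c i j =
   \sum_(0 <= k <oo) c (f k).1 (f k).2)%E.
Proof.
move=> c0; have /card_set_bijP[f fbij] := card_esym card_nat2.
exists f; split => //.
rewrite (nneseries_esumT (fun k => c0 (f k).1 (f k).2)).
under eq_eseriesr do rewrite (nneseries_esumT (c0 _)).
rewrite nneseries_esumT; last by move=> n; exact: esum_ge0.
rewrite esum_esum; last by [].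
rewrite -(reindex_esum _ _ _ (fun k => c k.1 k.2) fbij).
by congr esum; apply/seteqP; split => // -[].
Qed.

Lemma bigcup_pair_cover (T : Type) (F : nat -> nat -> set T) (f : nat -> nat * nat) (A : nat -> set T) :
  set_bij setT setT f ->
  (forall i, A i `<=` \bigcup_j F i j) ->
  \bigcup_i A i `<=` \bigcup_k F (f k).1 (f k).2.
Proof.
move=> [_ _ fsurj] AF t [i _ /AF[j _ Ft]].
by have [k _ fk] := fsurj (i, j) I; exists k => //; rewrite fk.
Qed.

Section hausdorff_outer.
Context (R : realType) (T : Type) (d : T -> T -> R) (s : R).
Hypothesis s0 : 0 < s.

Lemma diam0 : diam d set0 = -oo%E.
Proof.
rewrite /diam (_ : [set _ | _ in _ & _ in _] = set0) ?ereal_sup0//.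
by apply/seteqP; split => // x [].
Qed.

Lemma hcost0 : hcost d s set0 = 0.
Proof. by rewrite /hcost diam0 /= powR0// gt_eqF. Qed.

Lemma hcost_ge0 E : 0 <= hcost d s E.
Proof. exact: powR_ge0. Qed.

Lemma hausdorff_delta_ge0 delta A : (0 <= hausdorff_delta d s delta A)%E.
Proof.
apply: le_ereal_inf_tmp => _ [F _ <-].
by apply: nneseries_ge0 => i _ _; rewrite lee_fin hcost_ge0.
Qed.

Lemma le_hausdorff_delta delta A B : A `<=` B ->
  (hausdorff_delta d s delta A <= hausdorff_delta d s delta B)%E.
Proof.
move=> AB; apply: ereal_inf_le_tmp => _ [F [BF dF] <-].
by exists F => //; split => //; exact: subset_trans BF.
Qed.

Lemma hausdorff_delta_adherent delta A (e : R) : 0 < e ->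
  (hausdorff_delta d s delta A < +oo)%E ->
  exists F : nat -> set T, [/\ A `<=` \bigcup_i F i,
    forall i, (diam d (F i) <= delta%:E)%E &
    (\sum_(0 <= i <oo) (hcost d s (F i))%:E <= hausdorff_delta d s delta A + e%:E)%E].
Proof.
move=> e0 Afin.
have fA : hausdorff_delta d s delta A \is a fin_num.
  by rewrite ge0_fin_numE// hausdorff_delta_ge0.
have [_ [F [AF dF] <-] /ltW lF] := lb_ereal_inf_adherent e0 fA.
by exists F; split.
Qed.

Lemma hausdorff_delta_sigma_subadditive delta :
  sigma_subadditive (hausdorff_delta d s delta).
Proof.
move=> A; set H := hausdorff_delta d s delta.
have H0 i : (0 <= H (A i))%E by exact: hausdorff_delta_ge0.
(* If one term is infinite, so is the series. Otherwise every [A n] has a cover that is optimal up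
   to [e / 2 ^ n.+1]. *)
have [[i ioo]|] := pselect (exists i, H (A i) = +oo%E).
  by rewrite (eseries_pinfty _ _ ioo) ?leey// => n _; rewrite -ltNye (lt_le_trans _ (H0 n)).
rewrite -forallNE => Aoo.
apply/lee_addgt0Pr => e e0; apply: le_trans (epsilon_trick xpredT H0 (ltW e0)).
have /choice[F PF] : forall n, exists F : nat -> set T, [/\ A n `<=` \bigcup_i F i,
    forall i, (diam d (F i) <= delta%:E)%E &
    (\sum_(0 <= i <oo) (hcost d s (F i))%:E <= H (A n) + (e / (2 ^ n.+1)%:R)%:E)%E].
  move=> n; apply: hausdorff_delta_adherent.
    by rewrite divr_gt0// ltr0n expn_gt0.
  by rewrite ltey; apply/eqP; exact: Aoo.
have [f [fbij fE]] := @nneseries_pair _ (fun i j => (hcost d s (F i j))%:E)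
  (fun i j => hcost_ge0 (F i j)).
apply: (@le_trans _ _ (\sum_(0 <= i <oo) \sum_(0 <= j <oo) (hcost d s (F i j))%:E)%E).
  rewrite fE; apply: ereal_inf_lbound.
  exists (fun k => F (f k).1 (f k).2) => //; split.
    by apply: bigcup_pair_cover fbij _ => i; have [] := PF i.
  by move=> k; have [_ + _] := PF (f k).1.
apply: lee_nneseries => [i _ _|i _]; last by have [] := PF i.
by apply: nneseries_ge0 => j _ _; exact: hcost_ge0.
Qed.

Lemma hausdorff_ge_delta delta A : 0 < delta ->
  (hausdorff_delta d s delta A <= hausdorff d s A)%E.
Proof. by move=> d0; apply: ereal_sup_ubound; exists delta. Qed.

Lemma hausdorff_le A x :
  (forall delta, 0 < delta -> (hausdorff_delta d s delta A <= x)%E) ->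
  (hausdorff d s A <= x)%E.
Proof. by move=> h; apply: ge_ereal_sup => _ [e /= e0 <-]; exact: h. Qed.

Lemma hausdorff_ge0 A : (0 <= hausdorff d s A)%E.
Proof. exact: le_trans (hausdorff_delta_ge0 1 A) (hausdorff_ge_delta _ ltr01). Qed.

Lemma le_hausdorff : {homo hausdorff d s : A B / A `<=` B >-> (A <= B)%E}.
Proof.
move=> A B AB; apply: hausdorff_le => e e0.
exact: le_trans (le_hausdorff_delta _ AB) (hausdorff_ge_delta _ e0).
Qed.

Lemma hausdorff0 : hausdorff d s set0 = 0%E.
Proof.
apply/eqP; rewrite eq_le hausdorff_ge0 andbT; apply: hausdorff_le => e e0.
apply: ereal_inf_lbound; exists (fun=> set0).
  by split => // i; rewrite diam0 leNye.
by rewrite eseries0// => i _ _; rewrite hcost0.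
Qed.

Lemma hausdorff_sigma_subadditive : sigma_subadditive (hausdorff d s).
Proof.
move=> A; apply: hausdorff_le => e e0.
apply: (le_trans (hausdorff_delta_sigma_subadditive e A)).
apply: lee_nneseries => [i _ _|i _]; first exact: hausdorff_delta_ge0.
exact: hausdorff_ge_delta.
Qed.

Definition hausdorff_outer : {outer_measure set T -> \bar R} :=
  HB.pack (hausdorff d s) (isOuterMeasure.Build R T (hausdorff d s) hausdorff0
    hausdorff_ge0 le_hausdorff hausdorff_sigma_subadditive).

Lemma hausdorff_outerE A : hausdorff_outer A = hausdorff d s A.
Proof. by []. Qed.

End hausdorff_outer.

(** The two suprema are removed one after the other by subtraction, which needs finite operands.
    Nonnegativity and the bound [x] provide them once [x] is finite. *)
Lemma ereal_sup_add_le (R : realType) (S1 S2 : set (\bar R)) (x : \bar R) :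
  S1 !=set0 -> S2 !=set0 -> (forall a, S1 a -> 0 <= a)%E -> (forall b, S2 b -> 0 <= b)%E ->
  (forall a b, S1 a -> S2 b -> a + b <= x)%E ->
  (ereal_sup S1 + ereal_sup S2 <= x)%E.
Proof.
move=> [a0 Sa0] [b0 Sb0] p1 p2 h.
have [->|xoo] := eqVneq x +oo%E; first by rewrite leey.
have x0 : (0 <= x)%E by apply: le_trans (h _ _ Sa0 Sb0); apply: adde_ge0; [exact: p1|exact: p2].
have xfin : x \is a fin_num by rewrite ge0_fin_numE// ltey.
have s1x : (ereal_sup S1 <= x)%E.
  by apply: ge_ereal_sup => a Sa; apply: le_trans (h _ _ Sa Sb0); apply: leeDl; exact: p2.
have s10 : (0 <= ereal_sup S1)%E by apply: le_trans (p1 _ Sa0) (ereal_sup_ubound Sa0).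
have s1fin : ereal_sup S1 \is a fin_num.
  by rewrite ge0_fin_numE// (le_lt_trans s1x)// ltey.
rewrite addeC -leeBrDr//; apply: ge_ereal_sup => b Sb.
have bfin : b \is a fin_num.
  rewrite ge0_fin_numE; [|exact: p2]; rewrite (@le_lt_trans _ _ x)// ?ltey//.
  by apply: le_trans (h _ _ Sa0 Sb); apply: leeDr; exact: p1.
rewrite leeBrDr// addeC -leeBrDr//; apply: ge_ereal_sup => a Sa.
by rewrite leeBrDr// h.
Qed.

Section diam.
Context (R : realType) (T : Type) (d : T -> T -> R).
Hypothesis dm : is_metric d.

Lemma diam_leP (E : set T) (r : R) :
  (diam d E <= r%:E)%E <-> forall x y, E x -> E y -> d x y <= r.
Proof.
split=> [h x y Ex Ey|h].
  by rewrite -lee_fin; apply: le_trans h; apply: ereal_sup_ubound; exists x => //; exists y.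
by apply: ge_ereal_sup => _ [x Ex [y Ey <-]]; rewrite lee_fin h.
Qed.

Lemma diam_fin (E : set T) (r : R) x : E x -> (diam d E <= r%:E)%E ->
  diam d E = (fine (diam d E))%:E /\ 0 <= fine (diam d E).
Proof.
have [d0 dx _ _] := dm => Ex dE.
have D0 : (0 <= diam d E)%E.
  by apply: ereal_sup_ubound; exists x => //; exists x => //; rewrite (dx x x).2.
have Dfin : diam d E \is a fin_num by rewrite ge0_fin_numE// (le_lt_trans dE)// ltry.
by rewrite fineK//; split => //; exact: fine_ge0.
Qed.

Lemma hcost_le (s r : R) (E : set T) : 0 < s -> 0 <= r ->
  (forall x y, E x -> E y -> d x y <= r) -> hcost d s E <= r `^ s.
Proof.
move=> s0 r0 Er.
have [->|/set0P[x Ex]] := eqVneq E set0; first by rewrite hcost0// powR_ge0.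
have dE : (diam d E <= r%:E)%E by apply/diam_leP.
have [DE D0] := diam_fin Ex dE.
rewrite /hcost ge0_ler_powR// ?nnegrE ?(ltW s0)//.
by rewrite -lee_fin -DE.
Qed.

End diam.

(** * Hausdorff measure of Lipschitz images *)

Section lipschitz_image.
Context (R : realType) (X Y : Type) (d : X -> X -> R) (rho : Y -> Y -> R) (s L : R).
Variable f : X -> Y.
Hypotheses (dm : is_metric d) (rm : is_metric rho) (s0 : 0 < s) (L0 : 0 < L).
Hypothesis fL : forall x y, rho (f x) (f y) <= L * d x y.

Lemma hcost_image (E : set X) r : (diam d E <= r%:E)%E ->
  hcost rho s (f @` E) <= L `^ s * hcost d s E.
Proof.
move=> dE.
have [->|/set0P[x Ex]] := eqVneq E set0.
  by rewrite image_set0 !hcost0// mulr0.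
have [DE D0] := diam_fin dm Ex dE.
rewrite {2}/hcost -powRM ?(ltW L0)//; apply: hcost_le => //.
  by rewrite mulr_ge0// ltW.
move=> _ _ [u Eu <-] [v Ev <-]; apply: (le_trans (fL u v)); rewrite ler_pM2l//.
by move: u v Eu Ev; apply/diam_leP; rewrite -DE.
Qed.

(** [f] sends a cover of [A] of mesh [e / L] to a cover of its image of mesh [e], and multiplies
    each cost by at most [L ^ s]. *)
Lemma hausdorff_image (A : set X) :
  (hausdorff rho s (f @` A) <= (L `^ s)%:E * hausdorff d s A)%E.
Proof.
apply: hausdorff_le => e e0.
have Ls0 : 0 < L `^ s by rewrite powR_gt0.
have eL0 : 0 < e / L by rewrite divr_gt0.
apply: (@le_trans _ _ ((L `^ s)%:E * hausdorff_delta d s (e / L) A)%E); last first.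
  by rewrite lee_pmul2l ?fin_numE// hausdorff_ge_delta.
rewrite -lee_pdivrMl//; apply: le_ereal_inf_tmp => _ [F [AF dF] <-].
rewrite lee_pdivrMl// -nneseriesZl; last by move=> i _; rewrite lee_fin hcost_ge0.
apply: (@le_trans _ _ (\sum_(0 <= i <oo) (hcost rho s (f @` F i))%:E)%E).
  apply: ereal_inf_lbound; exists (fun i => f @` F i) => //; split.
    by move=> _ [x /AF[i _ Fx] <-]; exists i => //; exists x.
  move=> i; apply/diam_leP => _ _ [u Fu <-] [v Fv <-].
  apply: (le_trans (fL u v)); rewrite -ler_pdivlMl// mulrC.
  by move: u v Fu Fv; apply/diam_leP.
apply: lee_nneseries => [i _ _|i _]; first by rewrite lee_fin hcost_ge0.
by rewrite -EFinM lee_fin; exact: hcost_image (dF i).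
Qed.

End lipschitz_image.

Lemma le_hausdorff_delta_anti (R : realType) (T : Type) (d : T -> T -> R) (s e1 e2 : R)
  (A : set T) : e1 <= e2 -> (hausdorff_delta d s e2 A <= hausdorff_delta d s e1 A)%E.
Proof.
move=> e12; apply: ereal_inf_le_tmp => _ [F [AF dF] <-]; exists F => //; split => // i.
by apply: le_trans (dF i) _; rewrite lee_fin.
Qed.

(** * Superadditivity of the Hausdorff measure on separated sets *)

Section metric_outer.
Context (R : realType) (T : Type) (d : T -> T -> R) (s : R).
Hypotheses (dm : is_metric d) (s0 : 0 < s).

Definition dseparated (A B : set T) :=
  exists e, 0 < e /\ forall a b, A a -> B b -> e <= d a b.

(** A set of diameter below the gap [e] cannot meet both [A] and [B], so a cover of the union splits
    into two covers. [G C] replaces the sets that miss [C] by the empty set, whose cost is zero. *)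
Lemma hausdorff_delta_separated (A B : set T) (e delta : R) :
  (forall a b, A a -> B b -> e <= d a b) -> delta < e ->
  (hausdorff_delta d s delta A + hausdorff_delta d s delta B <=
   hausdorff_delta d s delta (A `|` B))%E.
Proof.
move=> AB de; apply: le_ereal_inf_tmp => _ [F [ABF dF] <-].
pose G (C : set T) i := if `[< F i `&` C !=set0 >] then F i else set0.
have HG C : C `<=` A `|` B ->
    (hausdorff_delta d s delta C <= \sum_(0 <= i <oo) (hcost d s (G C i))%:E)%E.
  move=> CAB; apply: ereal_inf_lbound; exists (G C) => //; split.
    move=> t Ct; have [i _ Ft] := ABF _ (CAB _ Ct); exists i => //.
    by rewrite /G; case: ifPn => // /asboolPn; case; exists t.
  by move=> i; rewrite /G; case: ifPn => // _; rewrite diam0 leNye.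
apply: (le_trans (leeD (HG A _) (HG B _))); [by move=> t; left|by move=> t; right|].
rewrite -nneseriesD; try by move=> i _ _; rewrite lee_fin hcost_ge0.
apply: lee_nneseries => [i _ _|i _].
  by rewrite -EFinD lee_fin addr_ge0// hcost_ge0.
rewrite -EFinD lee_fin /G; case: asboolP => [[a [Fa Aa]]|_]; case: asboolP => [[b [Fb Bb]]|_].
- have := AB _ _ Aa Bb; have /diam_leP/(_ _ _ Fa Fb) := dF i.
  by move=> /le_lt_trans/(_ de); rewrite ltNge => /negP.
- by rewrite hcost0// addr0.
- by rewrite hcost0// add0r.
- by rewrite hcost0// addr0 hcost_ge0.
Qed.

Lemma hausdorff_separated (A B : set T) : dseparated A B ->
  (hausdorff d s A + hausdorff d s B <= hausdorff d s (A `|` B))%E.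
Proof.
move=> [e [e0 AB]]; apply: ereal_sup_add_le.
- by exists (hausdorff_delta d s 1 A), 1 => //=.
- by exists (hausdorff_delta d s 1 B), 1 => //=.
- by move=> _ [x _ <-]; exact: hausdorff_delta_ge0.
- by move=> _ [x _ <-]; exact: hausdorff_delta_ge0.
move=> _ _ [x /= x0 <-] [y /= y0 <-].
(* Both premeasures grow as the scale shrinks, so the two scales can be lowered to a common one
   below the gap. *)
pose m := Num.min (Num.min x y) (e / 2).
have m0 : 0 < m by rewrite !lt_min x0 y0 divr_gt0.
have [mx my me] : [/\ m <= x, m <= y & m < e].
  split; first by rewrite !ge_min lexx.
    by rewrite !ge_min lexx orbT.
  by rewrite gt_min; apply/orP; right; lra.
apply: le_trans (hausdorff_ge_delta _ _ _ m0).
apply: le_trans (hausdorff_delta_separated AB me).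
by apply: leeD; exact: le_hausdorff_delta_anti.
Qed.

End metric_outer.

(** * Continuity of outer measures and the Caratheodory criterion *)

Lemma exists_invS_lt (R : realType) (e : R) : 0 < e -> exists n : nat, n.+1%:R^-1 < e.
Proof.
move=> e0; exists (Num.bound e^-1).
rewrite invf_plt ?posrE//; apply: lt_le_trans (archi_boundP _) _.
  by rewrite invr_ge0 ltW.
by rewrite ler_nat.
Qed.

Lemma nneseries_tail_le (R : realType) (f : nat -> \bar R) (e : R) :
  0 < e -> (forall k, 0 <= f k)%E -> (\sum_(0 <= k <oo) f k < +oo)%E ->
  exists n, (\sum_(n <= k <oo) f k <= e%:E)%E.
Proof.
move=> e0 f0 foo.
have cv := @nneseries_tail_cvg _ f xpredT foo (fun k _ => f0 k).
have [n _ nP] := cv _ (@nbhs_open_ereal_lt R 0 (fun=> e) e0).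
by exists n; apply: ltW; exact: (nP n (leqnn n)).
Qed.

Lemma nneseries_le (R : realType) (f : nat -> \bar R) (M : \bar R) :
  (forall k, 0 <= f k)%E -> (forall n, \sum_(0 <= k < n) f k <= M)%E ->
  (\sum_(0 <= k <oo) f k <= M)%E.
Proof.
move=> f0 h; apply: lime_le; first by apply: is_cvg_nneseries.
by apply: nearW => n; exact: h.
Qed.

Section outer_measure_continuity.
Context (R : realType) (T : Type) (mu : {outer_measure set T -> \bar R}).

Lemma outer_measure_fin (A B : set T) : A `<=` B -> (mu B < +oo)%E -> mu A \is a fin_num.
Proof.
move=> AB Boo; rewrite ge0_fin_numE; last exact: outer_measure_ge0.
by apply: le_lt_trans (le_outer_measure mu _ _ AB) Boo.
Qed.

(** What [A n] misses of the union lies in the sets [B k] with [k >= n], a tail of a convergent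
    series. Subadditivity is enough, so [A] and [B] may be arbitrary sets. *)
Lemma outer_measure_rings_tail (A B : nat -> set T) (e : R) : 0 < e ->
  (forall n, ~` A n `&` \bigcup_k A k `<=` \bigcup_(k in ~` `I_n) B k) ->
  (\sum_(0 <= k <oo) mu (B k) < +oo)%E ->
  exists n, (mu (\bigcup_k A k) <= mu (A n) + e%:E)%E.
Proof.
move=> e0 AB Boo.
have [n nP] := nneseries_tail_le e0 (fun k => outer_measure_ge0 mu (B k)) Boo.
exists n; apply: (@le_trans _ _ (mu (A n `|` \bigcup_(k in ~` `I_n) B k))).
  apply: le_outer_measure => t At; have [Ant|Ant] := pselect (A n t); first by left.
  by right; apply: AB.
apply: (le_trans (outer_measureU2 _ _ _)); apply: leeD2l.
exact: le_trans (outer_measure_sigma_subadditive_tail _ _ _) nP.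
Qed.

Lemma caratheodory_series_le (A : nat -> set T) (X : set T) :
  (forall n, mu.-caratheodory (A n)) -> trivIset setT A ->
  (\sum_(0 <= k <oo) mu (X `&` A k) <= mu X)%E.
Proof.
move=> mA tA; apply: le_trans (caratheodory_lime_le mA tA X).
by apply: leeDl; exact: outer_measure_ge0.
Qed.

Lemma caratheodory_measurable_bigcap (A : nat -> set T) :
  (forall n, mu.-caratheodory (A n)) -> mu.-caratheodory (\bigcap_n A n).
Proof.
move=> mA; rewrite -[X in _ X]setCK setC_bigcap.
apply/caratheodory_measurable_setC/caratheodory_measurable_bigcup => n.
exact/caratheodory_measurable_setC.
Qed.

(** Continuity from above at the empty set. The rings [B n] are disjoint and measurable inside
    [A 0], so their measures are summable, and the rings from [n] on cover [A n]. *)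
Lemma caratheodory_decreasing_small (A : nat -> set T) (e : R) :
  (forall n, mu.-caratheodory (A n)) -> (mu (A 0%N) < +oo)%E ->
  (forall n, A n.+1 `<=` A n) -> \bigcap_n A n = set0 -> 0 < e ->
  exists n, (mu (A n) <= e%:E)%E.
Proof.
move=> mA A0 decA capA e0.
have monA m n : (m <= n)%N -> A n `<=` A m.
  elim: n => [|n IH]; first by rewrite leqn0 => /eqP ->.
  by rewrite leq_eqVlt => /predU1P[->//|/IH]; exact: subset_trans (decA n).
pose B n := A n `\` A n.+1.
have mB n : mu.-caratheodory (B n) by apply: caratheodory_measurable_setD.
have tB : trivIset setT B.
  apply: ltn_trivIset => n m mn; apply/seteqP; split => // t [[_ nAt] [At _]].
  exact/nAt/(monA _ _ mn).
have Boo : (\sum_(0 <= k <oo) mu (A 0%N `&` B k) < +oo)%E.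
  exact: le_lt_trans (caratheodory_series_le _ mB tB) A0.
have [n nP] := nneseries_tail_le e0 (fun k => outer_measure_ge0 mu (A 0%N `&` B k)) Boo.
exists n; apply: le_trans nP; apply: le_trans (outer_measure_sigma_subadditive_tail _ _ _).
apply: le_outer_measure => t At.
have [m nm mAt] : exists2 m, (n <= m)%N & ~ A m.+1 t.
  apply: contrapT => h; have : (\bigcap_n A n) t.
    move=> k _; have [kn|nk] := leqP k n; first exact: monA At.
    apply: contrapT => At'; apply: h; exists k.-1; last by rewrite (ltn_predK nk).
    by rewrite -ltnS (ltn_predK nk).
  by rewrite capA.
(* By minimality of [i], the point [t] is still in [A i], hence in the ring [B i]. *)
have [i /andP[ni iAt] imin] : exists2 i, (n <= i)%N && `[< ~ A i.+1 t >] &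
    forall j, (n <= j)%N && `[< ~ A j.+1 t >] -> (i <= j)%N.
  have ex : exists i, (n <= i)%N && `[< ~ A i.+1 t >].
    by exists m; rewrite nm; apply/asboolP.
  by exists (ex_minn ex); case: ex_minnP.
move/asboolP in iAt.
exists i; first by apply/negP; rewrite -leqNgt.
split; first exact: monA At.
split => //; have [->//|] := eqVneq i n.
rewrite neq_ltn ltnNge ni/= => lni.
apply: contrapT => nAit.
have := imin i.-1; rewrite (ltn_predK lni) -ltnS (ltn_predK lni) lni/=.
by move=> /(_ (asboolT nAit)); rewrite -ltnS (ltn_predK lni) ltnn.
Qed.

End outer_measure_continuity.

Section metric_caratheodory.
Context (R : realType) (T : Type) (d : T -> T -> R) (mu : {outer_measure set T -> \bar R}).
Hypothesis dm : is_metric d.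
Hypothesis mu_sep : forall A B, dseparated d A B -> (mu A + mu B <= mu (A `|` B))%E.

(* Caratheodory's criterion: the sets [A n] of points of [X] at distance at least
   [1/(n+1)] from the complement of [O] exhaust [X `&` O], and the rings [B n] are
   separated from [A n], so that their measures telescope. *)
Lemma caratheodory_open (O : set T) : dopen d O -> mu.-caratheodory O.
Proof.
have [d0 dx dC dT] := dm.
move=> oO; apply: le_caratheodory_measurable => X.
have [->|Xoo] := eqVneq (mu X) +oo%E; first by rewrite leey.
have {}Xoo : (mu X < +oo)%E by rewrite ltey.
pose A n := [set x | X x /\ forall c, ~ O c -> n.+1%:R^-1 <= d x c].
pose B n := A n.+2 `\` A n.+1.
have monA m n : (m <= n)%N -> A m `<=` A n.
  move=> mn x [Xx h]; split => // c /h; apply: le_trans.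
  by rewrite lef_pV2 ?posrE// ler_nat ltnS.
have capA : X `&` O = \bigcup_k A k.
  apply/seteqP; split => [x [Xx Ox]|x [n _ [Xx h]]].
    have [r [r0 rO]] := oO _ Ox; have [n nr] := exists_invS_lt r0.
    exists n => //; split => // c Oc; apply: (le_trans (ltW nr)).
    by rewrite leNgt; apply/negP => /rO.
  split => //; apply: contrapT => /h.
  by rewrite (dx x x).2// leNgt invr_gt0 ltr0n.
have fA n : mu (A n) \is a fin_num by apply: outer_measure_fin Xoo => x [].
have fB n : mu (B n) \is a fin_num by apply: outer_measure_fin Xoo => x [[]].
pose a n := fine (mu (A n)); pose b n := fine (mu (B n)).
have ab n : a n + b n <= a n.+2.
  rewrite -lee_fin EFinD !fineK//; apply: le_trans (mu_sep _) _; last first.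
    by apply: le_outer_measure => x [|[]//]; apply: monA; rewrite leqW.
  exists (n.+1%:R^-1 - n.+2%:R^-1); split.
    by rewrite subr_gt0 ltf_pV2 ?posrE// ltr_nat.
  move=> x y [Xx hx] [[Xy _] nAy].
  have [c Oc yc] : exists2 c, ~ O c & d y c < n.+2%:R^-1.
    apply: contrapT => h; apply: nAy; split => // c Oc; rewrite leNgt.
    by apply/negP => yc; apply: h; exists c.
  rewrite lerBlDr; apply: le_trans (hx _ Oc) _; apply: le_trans (dT x y c) _.
  by rewrite lerD2l ltW.
have aM n : a n <= fine (mu X).
  rewrite fine_le// ?fA//; first by apply: outer_measure_fin Xoo.
  by apply: le_outer_measure => x [].
have a0 n : 0 <= a n by apply: fine_ge0; exact: outer_measure_ge0.
(* Two consecutive terms appear because [ab] advances the index by two: even and odd rings telescope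
   separately. *)
have sumB n : \sum_(0 <= k < n) b k <= a n + a n.+1.
  elim: n => [|n IH]; first by rewrite big_geq// addr_ge0.
  by rewrite big_nat_recr//=; have := ab n; lra.
have Boo : (\sum_(0 <= k <oo) mu (B k) < +oo)%E.
  apply: (@le_lt_trans _ _ (2 * fine (mu X))%:E); last by rewrite ltry.
  apply: nneseries_le => [k|n]; first exact: outer_measure_ge0.
  under eq_bigr do rewrite -(fineK (fB _)).
  rewrite sumEFin lee_fin; have := sumB n; have := aM n; have := aM n.+1; rewrite /b; lra.
apply/lee_addgt0Pr => e e0.
have [|n nP] := @outer_measure_rings_tail _ _ mu (fun n => A n.+1) B e e0 _ Boo.
  move=> n x [nAx [m _ Amx]].
  (* The first index at which [x] enters the family exceeds [n]. Its predecessor is the index of the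
     ring containing [x]. *)
  have ex : exists m, `[< A m.+1 x >] by exists m; exact/asboolP.
  have := ex_minnP ex; case=> i /asboolP iAx imin.
  have ni : (n < i)%N by rewrite ltnNge; apply/negP => ni; apply: nAx; exact: monA iAx.
  case: i => [//|i] in ni iAx imin *; exists i; first by apply/negP; rewrite -leqNgt -ltnS.
  split => // Aix; have := imin i (asboolT Aix); by rewrite ltnn.
have AE : \bigcup_n A n.+1 = X `&` O.
  rewrite capA; apply/seteqP; split => x [k _ kx]; first by exists k.+1.
  by exists k => //; exact: monA kx.
rewrite AE in nP.
apply: (@le_trans _ _ (mu (A n.+1) + e%:E + mu (X `&` ~` O))%E); first exact: leeD2r.
rewrite addeAC; apply: leeD2r; apply: le_trans (mu_sep _) _; last first.
  by apply: le_outer_measure => x [[]|[]].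
exists (n.+2%:R^-1); split; first by rewrite invr_gt0.
by move=> x c [_ h] [_ /h].
Qed.

End metric_caratheodory.

(** * Ultralimits, compactness and tightness *)

Lemma exists_ultrafilter_nat : exists U : set_system nat, UltraFilter U /\ \oo `<=` U.
Proof. exact: ultraFilterLemma. Qed.

Lemma ultra_bigcup (T : Type) (U : set_system T) (A : nat -> set T) (n : nat) :
  UltraFilter U -> U (\bigcup_(i < n) A i) -> exists2 i, (i < n)%N & U (A i).
Proof.
move=> UF; elim: n => [|n IH] UA.
  by exfalso; apply: (@filter_not_empty _ U); apply: filterS UA => t [].
have [UAn|UAn] := in_ultra_setVsetC (A n) UF; first by exists n.
have [|i lin UAi] := IH; last by exists i => //; exact: leqW.
apply: filterS (filterI UA UAn) => t [[i /= lin Ait] nAt].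
exists i => //=; rewrite ltn_neqAle -ltnS lin andbT.
by apply/eqP => iE; apply: nAt; rewrite -iE.
Qed.

Section ultralimits.
Context (R : realType) (U : set_system nat).
Hypotheses (UF : UltraFilter U) (Uoo : \oo `<=` U).

(* Limits along one fixed non-principal ultrafilter replace the extraction of
   subsequences, and give simultaneous limits of several sequences for free. *)
Definition ulim (T : Type) (d : T -> T -> R) (u : nat -> T) (x : T) :=
  forall e, 0 < e -> U [set k | d (u k) x < e].

Definition ucompact (T : Type) (d : T -> T -> R) (K : set T) :=
  forall u, (forall k, K (u k)) -> exists2 x, K x & ulim d u x.

Section one_space.
Context (T : Type) (d : T -> T -> R).
Hypothesis dm : is_metric d.

Lemma ulim_cst (x : T) : ulim d (fun=> x) x.
Proof.
have [d0 dx dC dT] := dm; move=> e e0.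
by apply: filterS filterT => k _ /=; rewrite (dx x x).2.
Qed.

Lemma ulim_dist_le (u v : nat -> T) x y r : ulim d u x -> ulim d v y ->
  U [set k | d (u k) (v k) <= r] -> d x y <= r.
Proof.
have [d0 dx dC dT] := dm => ux vy Ur; apply/ler_addgt0Pr => e e0.
have e20 : 0 < e / 2 by lra.
have [k [[/= kx ky] kr]] := filter_ex (filterI (filterI (ux _ e20) (vy _ e20)) Ur).
have := dT x (u k) y; have := dT (u k) (v k) y; rewrite (dC x (u k)).
by move: kr => /=; lra.
Qed.

Lemma ulim_dist_ge (u v : nat -> T) x y r : ulim d u x -> ulim d v y ->
  U [set k | r <= d (u k) (v k)] -> r <= d x y.
Proof.
have [d0 dx dC dT] := dm => ux vy Ur; apply/ler_addgt0Pr => e e0.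
have e20 : 0 < e / 2 by lra.
have [k [[/= kx ky] kr]] := filter_ex (filterI (filterI (ux _ e20) (vy _ e20)) Ur).
have := dT (u k) x (v k); have := dT x y (v k); rewrite (dC y (v k)).
by move: kr => /=; lra.
Qed.

Lemma ulim_unique (u : nat -> T) x y : ulim d u x -> ulim d u y -> x = y.
Proof.
have [d0 dx dC dT] := dm => ux uy; apply/dx/eqP; rewrite eq_le d0 andbT.
apply: (ulim_dist_le ux uy).
by apply: filterS filterT => k _ /=; rewrite (dx (u k) (u k)).2.
Qed.

Lemma ulim_seq (u : nat -> T) x : (forall n, d (u n) x < n.+1%:R^-1) -> ulim d u x.
Proof.
move=> ux e e0; apply: Uoo; have [n ne] := exists_invS_lt e0.
exists n => // k /= nk; apply: (lt_trans (ux k)); apply: le_lt_trans ne.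
by rewrite lef_pV2 ?posrE// ler_nat ltnS.
Qed.

(** If the complement is not open at [x], points of [C] within [1/(n+1)] of [x] form a sequence that
    converges to [x], hence also along [U]. *)
Lemma dopenC_ulim (C : set T) : 
  (forall u x, (forall k, C (u k)) -> ulim d u x -> C x) -> dopen d (~` C).
Proof.
have [d0 dx dC dT] := dm; move=> h x nCx; apply: contrapT => nr.
have /choice[u uP] : forall n : nat, exists y, C y /\ d y x < n.+1%:R^-1.
  move=> n; apply: contrapT => ny; apply: nr; exists n.+1%:R^-1.
  split; first by rewrite invr_gt0.
  by move=> y; rewrite /dball /= dC => xy Cy; apply: ny; exists y.
apply: nCx; apply: (h u x); first by move=> k; have [] := uP k.
by apply: ulim_seq => k; have [] := uP k.
Qed.

Lemma ulim_closed (C : set T) (u : nat -> T) x : dopen d (~` C) ->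
  (forall k, C (u k)) -> ulim d u x -> C x.
Proof.
have [d0 dx dC dT] := dm; move=> oC Cu ux; apply: contrapT => /oC[r [r0 rC]].
have [k /= ukx] := filter_ex (ux r r0).
by apply: (rC (u k)) (Cu k); rewrite /dball /= dC.
Qed.

Lemma ucompact_dopenC (K : set T) : ucompact d K -> dopen d (~` K).
Proof.
move=> cK; apply: dopenC_ulim => u x Ku ux.
by have [y Ky uy] := cK u Ku; rewrite (ulim_unique ux uy).
Qed.

Lemma ucompactI (K C : set T) : ucompact d K -> dopen d (~` C) -> ucompact d (K `&` C).
Proof.
move=> cK oC u KCu; have [x Kx ux] := cK u (fun k => (KCu k).1).
by exists x => //; split => //; apply: ulim_closed ux => // k; have [] := KCu k.
Qed.

Lemma dopenC_cball (a : T) (r : R) : dopen d (~` [set x | d a x <= r]).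
Proof.
apply: dopenC_ulim => u x ur ux; apply: (ulim_dist_le (ulim_cst a) ux).
by apply: filterS filterT => k _; exact: ur.
Qed.

Lemma dopenC_coball (a : T) (r : R) : dopen d (~` [set x | r <= d a x]).
Proof.
apply: dopenC_ulim => u x ur ux; apply: (ulim_dist_ge (ulim_cst a) ux).
by apply: filterS filterT => k _; exact: ur.
Qed.

(** At each scale [U] selects one of finitely many balls, containing [u k] for [U]-many [k]. Points
    [u (w n)] in the first [n + 1] selected balls form a Cauchy sequence, and its limit is the limit
    of [u] along [U]. The balls are closed so that this limit stays in them. *)
Lemma ucompact_totally_bounded (q : nat -> T) (m : nat -> nat) : complete_metric d ->
  ucompact d [set x | forall n, exists2 i, (i < m n)%N & d (q i) x <= n.+1%:R^-1].
Proof.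
have [d0 dx dC dT] := dm; move=> cd u Ku.
have /choice[i iP] : forall n, exists i, (i < m n)%N /\ U [set k | d (q i) (u k) <= n.+1%:R^-1].
  move=> n; have [|i im Ui] := @ultra_bigcup _ U
    (fun i => [set k | d (q i) (u k) <= n.+1%:R^-1]) (m n) UF; last by exists i.
  by apply: filterS filterT => k _; have [i ? ?] := Ku k n; exists i.
have US n : U [set k | forall j, (j <= n)%N -> d (q (i j)) (u k) <= j.+1%:R^-1].
  elim: n => [|n IH].
    by apply: filterS (iP 0%N).2 => k /= h j; rewrite leqn0 => /eqP ->.
  apply: filterS (filterI IH (iP n.+1).2) => k /= [h1 h2] j.
  by rewrite leq_eqVlt => /predU1P[->//|]; exact: h1.
have /choice[w wP] : forall n, exists k, forall j, (j <= n)%N -> d (q (i j)) (u k) <= j.+1%:R^-1.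
  by move=> n; exact: filter_ex (US n).
have uw N k n : d (q (i N)) (u k) <= N.+1%:R^-1 -> (N <= n)%N ->
    d (u k) (u (w n)) <= N.+1%:R^-1 + N.+1%:R^-1.
  move=> kN Nn; apply: (le_trans (dT _ (q (i N)) _)); apply: lerD.
    by rewrite dC.
  exact: wP.
have small (e : R) : 0 < e -> exists N : nat, N.+1%:R^-1 + N.+1%:R^-1 < e.
  move=> e0; have [|N Ne] := @exists_invS_lt R (e / 2); first by lra.
  by exists N; rewrite [ltRHS]splitr ltrD.
have [x wx] : exists x, dconverges d (fun n => u (w n)) x.
  apply: cd => e /small[N Ne]; exists N => a b Na Nb; apply: le_lt_trans Ne.
  by apply: uw => //; exact: wP.
have ux : ulim d u x.
  move=> e e0; have [|N Ne] := small (e / 2); first by lra.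
  have [|M MP] := wx (e / 2); first by lra.
  apply: filterS (iP N).2 => k /= kN.
  (* Beyond [N] the point [u (w n)] shares a small ball with [u k]; beyond [M] it is close to
     [x]. *)
  have := le_lt_trans (uw N k (maxn N M) kN (leq_maxl _ _)) Ne.
  have := MP _ (leq_maxr N M); have := dT (u k) (u (w (maxn N M))) x.
  by clear kN Ne; lra.
exists x => // n; exists (i n); first by have [] := iP n.
by apply: (ulim_dist_le (ulim_cst _) ux); have [_] := iP n.
Qed.

End one_space.

Lemma ulim_lipschitz (X Y : Type) (d : X -> X -> R) (rho : Y -> Y -> R) (f : X -> Y) L u x :
  0 < L -> (forall x y, rho (f x) (f y) <= L * d x y) ->
  ulim d u x -> ulim rho (f \o u) (f x).
Proof.
move=> L0 fL ux e e0; have eL : 0 < e / L by rewrite divr_gt0.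
apply: filterS (ux _ eL) => k /= h; apply: (le_lt_trans (fL _ _)).
by rewrite mulrC -ltr_pdivlMr.
Qed.

End ultralimits.

Definition ddense (R : realType) (T : Type) (d : T -> T -> R) (q : nat -> T) :=
  forall x e, 0 < e -> exists m, d (q m) x < e.

(** Finite measure yields a countable cover of mesh [1/(n+1)] for each [n]; one point per covering
    set gives a dense sequence. [x0] stands in for empty covering sets and invalid codes. *)
Lemma hausdorff_separable (R : realType) (T : Type) (d : T -> T -> R) (s : R) (x0 : T) :
  is_metric d -> (hausdorff d s setT < +oo)%E -> exists q, ddense d q.
Proof.
move=> dm Hoo.
have /choice[F FP] : forall n : nat, exists F : nat -> set T, setT `<=` \bigcup_i F i /\
    forall i, (diam d (F i) <= (n.+1%:R^-1)%:E)%E.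
  move=> n; have n0 : (0 : R) < n.+1%:R^-1 by rewrite invr_gt0.
  have [|F [TF dF _]] := @hausdorff_delta_adherent R T d s n.+1%:R^-1 setT 1 ltr01.
    by apply: le_lt_trans Hoo; exact: hausdorff_ge_delta.
  by exists F.
have /choice[p pP] : forall ni : nat * nat, exists x, F ni.1 ni.2 !=set0 -> F ni.1 ni.2 x.
  move=> ni; have [[x Fx]|nF] := pselect (F ni.1 ni.2 !=set0); first by exists x.
  by exists x0.
exists (fun m => if unpickle m is Some ni then p ni else x0) => x e e0.
have [n ne] := exists_invS_lt e0; have [TF dF] := FP n.
have [i _ Fx] := TF x I; exists (pickle (n, i)); rewrite pickleK.
apply: le_lt_trans ne; have /diam_leP := dF i; apply => //.
by apply: (pP (n, i)); exists x.
Qed.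

Section tightness.
Context (R : realType) (T : Type) (d : T -> T -> R) (mu : {outer_measure set T -> \bar R}).
Hypotheses (dm : is_metric d) (cd : complete_metric d).
Hypothesis mu_open : forall O, dopen d O -> mu.-caratheodory O.
Hypothesis muT : (mu setT < +oo)%E.

(** Ulam's argument: finitely many closed balls of radius [1/(n+1)] around the dense points miss
    measure at most [e / 2 ^ n.+1]. The points missed at no scale form a compact set by
    completeness, and the losses add up to at most [e]. *)
Lemma outer_measure_tight (U : set_system nat) (q : nat -> T) (e : R) :
  UltraFilter U -> \oo `<=` U -> ddense d q -> 0 < e ->
  exists2 K, ucompact U d K & (mu (~` K) <= e%:E)%E.
Proof.
have [d0 dx dC dT] := dm; move=> UF Uoo qd e0.
pose A (n m : nat) := [set x | forall i, (i < m)%N -> n.+1%:R^-1 < d (q i) x].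
have mA n m : mu.-caratheodory (A n m).
  rewrite (_ : A n m = ~` \bigcup_(i in `I_m) [set x | d (q i) x <= n.+1%:R^-1]).
    rewrite bigcup_mkord; apply: caratheodory_measurable_setC.
    apply: (@caratheodory_measurable_bigsetU _ _ mu (fun i => [set x | d (q i) x <= n.+1%:R^-1])) => i.
    rewrite -[X in _ X]setCK; apply: caratheodory_measurable_setC; apply: mu_open.
    exact: (dopenC_cball UF Uoo dm).
  apply/seteqP; split => [x Ax [i /= im] |x nA i im].
    by rewrite leNgt Ax.
  by rewrite ltNge; apply/negP => h; apply: nA; exists i.
have /choice[m mP] : forall n, exists m, (mu (A n m) <= (e / (2 ^ n.+1)%:R)%:E)%E.
  move=> n; apply: caratheodory_decreasing_small => //.
  - by apply: le_lt_trans muT; apply: le_outer_measure.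
  - by move=> k x Ax i ik; apply: Ax; exact: leqW.
  - apply/seteqP; split => // x Ax.
    have [|i ix] := qd x n.+1%:R^-1; first by rewrite invr_gt0.
    by have := Ax i.+1 I i (leqnn _); rewrite ltNge (ltW ix).
  by rewrite divr_gt0// ltr0n expn_gt0.
exists [set x | forall n, exists2 i, (i < m n)%N & d (q i) x <= n.+1%:R^-1].
  exact: ucompact_totally_bounded.
apply: (@le_trans _ _ (mu (\bigcup_n A n (m n)))).
  apply: le_outer_measure => x; apply: contra_notP => nA n.
  apply: contrapT => h; apply: nA; exists n => // i im.
  by rewrite ltNge; apply/negP => ?; apply: h; exists i.
apply: (le_trans (outer_measure_sigma_subadditive mu _)).
have := @epsilon_trick R (fun=> 0%E) e xpredT (fun=> lexx _) (ltW e0).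
rewrite [X in (_ <= X + _)%E]eseries0// add0e; apply: le_trans.
by apply: lee_nneseries => [i _ _|i _]; [exact: outer_measure_ge0|rewrite add0e].
Qed.

End tightness.

(** * Fibres over a compact set *)

Section multiplicity.
Context (R : realType) (X Y : Type) (d : X -> X -> R) (rho : Y -> Y -> R) (f : X -> Y).
Context (muX : {outer_measure set X -> \bar R}) (muY : {outer_measure set Y -> \bar R}).
Context (L c : R) (U : set_system nat) (q : nat -> X).
Hypotheses (dm : is_metric d) (rm : is_metric rho).
Hypotheses (L0 : 0 < L) (fL : forall x y, rho (f x) (f y) <= L * d x y).
Hypothesis mu_open : forall O, dopen d O -> muX.-caratheodory O.
Hypothesis muXT : (muX setT < +oo)%E.
Hypotheses (c0 : 0 < c) (muYf : forall A, (muY (f @` A) <= c%:E * muX A)%E).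
Hypotheses (UF : UltraFilter U) (Uoo : \oo `<=` U) (qd : ddense d q).

Definition close_fiber (K : set X) (n : nat) : set Y :=
  [set y | exists u v, [/\ K u, K v, f u = y, f v = y & 0 < d u v <= n.+1%:R^-1]].

(** For compact [K] these are the points whose fibre in [K] is infinite. *)
Definition accumulating_fiber (K : set X) : set Y := \bigcap_n close_fiber K n.

Lemma caratheodory_closed C : dopen d (~` C) -> muX.-caratheodory C.
Proof. by move=> /mu_open/caratheodory_measurable_setC; rewrite setCK. Qed.

(** The condition [0 < d u v] is not stable under limits. Bounding [d u v] below by [1/(m+1)] gives,
    for each [m], a closed set, as both witnesses converge along [U]; the preimage is the union over
    [m]. *)
Lemma close_fiber_caratheodory K n : ucompact U d K ->
  muX.-caratheodory (f @^-1` close_fiber K n).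
Proof.
move=> cK.
rewrite (_ : f @^-1` _ = \bigcup_m [set x | exists u v, [/\ K u, K v, f u = f x, f v = f x &
    m.+1%:R^-1 <= d u v <= n.+1%:R^-1]]).
  apply: caratheodory_measurable_bigcup => m; apply: caratheodory_closed.
  apply: (dopenC_ulim Uoo dm) => w x /choice[u /choice[v uv]] wx.
  have [a Ka ua] := cK u (fun k => let: And5 h _ _ _ _ := uv k in h).
  have [b Kb vb] := cK v (fun k => let: And5 _ h _ _ _ := uv k in h).
  exists a, b; split => //.
  - apply: (ulim_unique UF rm (ulim_lipschitz UF L0 fL ua)).
    move=> e /(ulim_lipschitz UF L0 fL wx); apply: filterS => k /=.
    by have [_ _ -> _ _] := uv k.
  - apply: (ulim_unique UF rm (ulim_lipschitz UF L0 fL vb)).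
    move=> e /(ulim_lipschitz UF L0 fL wx); apply: filterS => k /=.
    by have [_ _ _ -> _] := uv k.
  - apply/andP; split.
      apply: (ulim_dist_ge UF dm ua vb); apply: filterS filterT => k _ /=.
      by have [_ _ _ _ /andP[]] := uv k.
    apply: (ulim_dist_le UF dm ua vb); apply: filterS filterT => k _ /=.
    by have [_ _ _ _ /andP[]] := uv k.
apply/seteqP; split => [x [u [v [Ku Kv fu fv /andP[d0 dn]]]]|x [m _ [u [v [Ku Kv fu fv /andP[md dn]]]]]].
  have [m md] := exists_invS_lt d0; exists m => //; exists u, v; split => //.
  by rewrite (ltW md).
by exists u, v; split => //; rewrite dn (lt_le_trans _ md)// invr_gt0.
Qed.

Lemma accumulating_fiber_caratheodory K : ucompact U d K ->
  muX.-caratheodory (f @^-1` accumulating_fiber K).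
Proof.
move=> cK; rewrite /accumulating_fiber preimage_bigcap.
by apply: caratheodory_measurable_bigcap => n; exact: close_fiber_caratheodory.
Qed.

(** The radii of the near and far parts differ by a factor 2, so both are closed and they are
    disjoint. *)
Let near_part (j n : nat) : set X := [set x | d (q j) x <= n.+1%:R^-1].
Let far_part (j n : nat) : set X := [set x | 2 * n.+1%:R^-1 <= d (q j) x].

(** Ever closer pairs in the fibre converge along [U] to one point [z] of it. A small ball around a
    dense point near [z] contains arbitrarily close pairs and leaves another point [w] of the fibre
    far outside. *)
Lemma accumulating_fiber_split K y : ucompact U d K -> accumulating_fiber K y ->
  exists j n, accumulating_fiber (K `&` near_part j n) y /\
    (f @` (K `&` far_part j n)) y.
Proof.
have [d0 dx dC dT] := dm; move=> cK Ky.
have /choice[u /choice[v uv]] : forall n, exists u v,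
    [/\ K u, K v, f u = y, f v = y & 0 < d u v <= n.+1%:R^-1] by move=> n; exact: Ky.
have [z Kz uz] := cK u (fun k => let: And5 h _ _ _ _ := uv k in h).
have fz : f z = y.
  apply: (ulim_unique UF rm (ulim_lipschitz UF L0 fL uz)).
  move=> e /(ulim_cst UF rm y); apply: filterS => k /=.
  by have [_ _ -> _ _] := uv k.
have vz : ulim U d v z.
  move=> e e0; have e20 : 0 < e / 2 by lra.
  have [N Ne] := exists_invS_lt e20.
  have UN : U [set k | (N <= k)%N] by apply: Uoo; exists N.
  apply: filterS (filterI (uz _ e20) UN) => k [/= uke Nk].
  have [_ _ _ _ /andP[_ uvk]] := uv k.
  have {}uvk : d (v k) (u k) < e / 2.
    rewrite dC; apply: le_lt_trans Ne; apply: (le_trans uvk).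
    by rewrite lef_pV2 ?posrE// ler_nat ltnS.
  by have := dT (v k) (u k) z; clear Ne; lra.
have [w [Kw fw wz]] : exists w, [/\ K w, f w = y & 0 < d w z].
  have [Ku Kv fu fv /andP[uv0 _]] := uv 0%N.
  (* [u 0] and [v 0] are distinct, so one of them differs from [z]. *)
  have [uz0|] := eqVneq (d (u 0%N) z) 0; last first.
    by move=> h; exists (u 0%N); split => //; rewrite lt_neqAle eq_sym h d0.
  exists (v 0%N); split => //; rewrite dC.
  by move/dx : uz0 => <-.
have [|n nw] := @exists_invS_lt R (d w z / 4); first by lra.
set a : R := n.+1%:R^-1 in nw.
have a0 : 0 < a by rewrite invr_gt0.
have a20 : 0 < a / 2 by lra.
have [j jz] := qd z a20.
exists j, n; split; last first.
  exists w => //; split => //; rewrite /far_part /= -/a.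
  by have := dT w (q j) z; rewrite (dC w (q j)); lra.
move=> N _.
have UN : U [set k | (N <= k)%N] by apply: Uoo; exists N.
have [k [[/= uka vka] Nk]] := filter_ex (filterI (filterI (uz _ a20) (vz _ a20)) UN).
have [Ku Kv fu fv /andP[uv0 uvk]] := uv k.
exists (u k), (v k); split => //.
- split => //; rewrite /near_part /= -/a.
  by have := dT (q j) z (u k); rewrite (dC z (u k)); lra.
- split => //; rewrite /near_part /= -/a.
  by have := dT (q j) z (v k); rewrite (dC z (v k)); lra.
- rewrite uv0 (le_trans uvk)//.
  by rewrite lef_pV2 ?posrE// ler_nat ltnS.
Qed.

Lemma ucompact_image_preimage K : ucompact U d K -> muX.-caratheodory (f @^-1` (f @` K)).
Proof.
move=> cK; apply: caratheodory_closed; apply: (dopenC_ulim Uoo dm) => w x wK wx.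
have /choice[u uw] : forall k, exists u, K u /\ f u = f (w k).
  by move=> k; have [u Ku fu] := wK k; exists u.
have [a Ka ua] := cK u (fun k => (uw k).1).
exists a => //; apply: (ulim_unique UF rm (ulim_lipschitz UF L0 fL ua)).
move=> e /(ulim_lipschitz UF L0 fL wx); apply: filterS => k /=.
by have [_ ->] := uw k.
Qed.

(* An infinite fibre has, for some small ball, a point outside and infinitely many
   points inside: each induction step peels off one more preimage. *)
Lemma accumulating_fiber_mul k K W : ucompact U d K -> W `<=` accumulating_fiber K ->
  muX.-caratheodory (f @^-1` W) ->
  (k%:R%:E * muY W <= c%:E * muX (K `&` f @^-1` W))%E.
Proof.
elim: k K W => [|k IH] K W cK WK mW.
  by rewrite mul0e mule_ge0 ?lee_fin ?(ltW c0)// outer_measure_ge0.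
have cnear j n : ucompact U d (K `&` near_part j n).
  by apply: ucompactI => //; exact: (dopenC_cball UF Uoo dm).
have cfar j n : ucompact U d (K `&` far_part j n).
  by apply: ucompactI => //; exact: (dopenC_coball UF Uoo dm).
(* The separating balls are enumerated by codes [e]. Below, [seqDU] makes these sets disjoint, so
   that each point of [W] is treated with a single ball. *)
pose V e := if unpickle e is Some (j, n) then
   W `&` accumulating_fiber (K `&` near_part j n) `&` f @` (K `&` far_part j n) else set0.
have mV e : muX.-caratheodory (f @^-1` V e).
  rewrite /V; case: (unpickle e) => [[j n]|]; last first.
    by rewrite preimage_set0; exact: caratheodory_measurable_set0.
  rewrite !preimage_setI; apply: caratheodory_measurable_setI.
    apply: caratheodory_measurable_setI => //.
    exact: accumulating_fiber_caratheodory.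
  exact: ucompact_image_preimage.
have WV : W `<=` \bigcup_e seqDU V e.
  rewrite -seqDU_bigcup_eq => y Wy.
  have [j [n [ny fy]]] := accumulating_fiber_split cK (WK _ Wy).
  by exists (pickle (j, n)) => //; rewrite /V pickleK.
have pV e : f @^-1` seqDU V e = seqDU (fun e => f @^-1` V e) e.
  rewrite /seqDU -bigcup_mkord -(bigcup_mkord _ (fun k => f @^-1` V k)).
  by apply/seteqP; split.
have mDV e : muX.-caratheodory (f @^-1` seqDU V e).
  rewrite pV; apply: caratheodory_measurable_setD => //.
  exact: (@caratheodory_measurable_bigsetU _ _ muX (fun e => f @^-1` V e)).
have step e : (k.+1%:R%:E * muY (seqDU V e) <= c%:E * muX (K `&` f @^-1` W `&` f @^-1` seqDU V e))%E.
  have sV : seqDU V e `<=` V e by move=> y [].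
  move: sV; rewrite /V; case: (unpickle e) => [[j n]|] sV; last first.
    rewrite (_ : muY _ = 0%E) ?mule0.
      by rewrite mule_ge0 ?lee_fin ?(ltW c0)// outer_measure_ge0.
    by rewrite (_ : seqDU V e = set0) ?outer_measure0//; apply/seteqP; split.
  set Z := seqDU V e in sV *.
  (* The induction hypothesis accounts for [k] preimages in the near part, [h2] for one more in the
     far part. As [near_part] is measurable, the two measures add. *)
  have h1 : (k%:R%:E * muY Z <= c%:E * muX (K `&` near_part j n `&` f @^-1` Z))%E.
    by apply: IH => // [y /sV[[]]|]; [|exact: mDV].
  have h2 : (muY Z <= c%:E * muX (K `&` far_part j n `&` f @^-1` Z))%E.
    apply: le_trans (muYf _); apply: le_outer_measure => y Zy.
    by have [_ [x Kx xy]] := sV _ Zy; exists x => //; split => //=; rewrite xy.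
  rewrite -natr1 EFinD ge0_muleDl ?mul1e ?lee_fin//.
  apply: (le_trans (leeD h1 h2)).
  rewrite -ge0_muleDr ?outer_measure_ge0//; apply: lee_wpmul2l; first by rewrite lee_fin ltW.
  have mN : muX.-caratheodory (near_part j n).
    by apply: caratheodory_closed; exact: (dopenC_cball UF Uoo dm).
  rewrite (mN (K `&` f @^-1` W `&` _)); apply: leeD; apply: le_outer_measure.
    by move=> x [[Kx nx] Zx]; have [[Wx _] _] := sV _ Zx.
  move=> x [[Kx nx] Zx]; have [[Wx _] _] := sV _ Zx; split => //.
  move: nx; rewrite /far_part /near_part /= => h1' h2'.
  have : 0 < n.+1%:R^-1 :> R by rewrite invr_gt0.
  by have := le_trans h1' h2'; move: (n.+1%:R^-1) => a; lra.
apply: (@le_trans _ _ (k.+1%:R%:E * \sum_(0 <= e <oo) muY (seqDU V e))%E).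
  apply: lee_wpmul2l; first by rewrite lee_fin.
  apply: le_trans (outer_measure_sigma_subadditive muY _).
  exact: le_outer_measure.
rewrite -nneseriesZl; last by move=> e _; exact: outer_measure_ge0.
apply: (@le_trans _ _ (\sum_(0 <= e <oo) c%:E * muX (K `&` f @^-1` W `&` f @^-1` seqDU V e))%E).
  apply: lee_nneseries => // e _ _.
  by rewrite mule_ge0 ?lee_fin// outer_measure_ge0.
rewrite nneseriesZl; last by move=> e _; exact: outer_measure_ge0.
apply: lee_wpmul2l; first by rewrite lee_fin ltW.
apply: caratheodory_series_le => //.
move=> i j _ _ [x [ix jx]]; apply: (trivIset_seqDU V) => //.
by exists (f x).
Qed.

(** Every multiple [k] of this measure is below the same finite bound, so it vanishes by the
    Archimedean property. *)
Lemma accumulating_fiber_null K : ucompact U d K -> muY (accumulating_fiber K) = 0%E.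
Proof.
move=> cK.
have bnd k : (k%:R%:E * muY (accumulating_fiber K) <= c%:E * muX setT)%E.
  apply: le_trans (accumulating_fiber_mul k cK (@subset_refl _ _) _) _.
    exact: accumulating_fiber_caratheodory.
  by apply: lee_wpmul2l; [rewrite lee_fin ltW|exact: le_outer_measure].
have Mfin : (c%:E * muX setT)%E \is a fin_num.
  by rewrite fin_numM//; apply: outer_measure_fin muXT.
have a0 := outer_measure_ge0 muY (accumulating_fiber K).
have afin : muY (accumulating_fiber K) \is a fin_num.
  rewrite ge0_fin_numE//; have := bnd 1%N; rewrite mul1e => /le_lt_trans; apply.
  by rewrite ltey_eq Mfin.
move: a0 bnd; rewrite -(fineK afin) -(fineK Mfin).
set a := fine _; set M := fine _; rewrite lee_fin => a0 bnd.
congr (_%:E); apply/eqP; rewrite eq_le a0 andbT leNgt; apply/negP => a1.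
have := bnd (Num.bound (M / a)); rewrite -EFinM lee_fin leNgt => /negP; apply.
rewrite -ltr_pdivrMr//; apply: archi_boundP; rewrite divr_ge0// -lee_fin.
by have := bnd 0%N; rewrite mul0e.
Qed.

(** Without the accumulating fibres these measurable sets decrease to the empty set. *)
Lemma close_fiber_small K e : ucompact U d K -> 0 < e ->
  exists n, (muX (K `&` f @^-1` (close_fiber K n `\` accumulating_fiber K)) <= e%:E)%E.
Proof.
move=> cK e0.
apply: (@caratheodory_decreasing_small _ _ muX
  (fun n => K `&` f @^-1` (close_fiber K n `\` accumulating_fiber K))) => //.
- move=> n; apply: caratheodory_measurable_setI.
    by apply: caratheodory_closed; apply: (ucompact_dopenC UF Uoo dm).
  rewrite (_ : _ @^-1` _ = f @^-1` close_fiber K n `\` f @^-1` accumulating_fiber K)//.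
  apply: caratheodory_measurable_setD; first exact: close_fiber_caratheodory.
  exact: accumulating_fiber_caratheodory.
- by apply: le_lt_trans muXT; exact: le_outer_measure.
- move=> n x [Kx [[u [v [Ku Kv fu fv /andP[uv0 uvn]]]] nx]]; split => //; split => //.
  exists u, v; split => //; rewrite uv0 (le_trans uvn)//.
  by rewrite lef_pV2 ?posrE// ler_nat.
- apply/seteqP; split => // x h; have [_ [_ nacc]] := h 0%N I.
  by apply: nacc => n _; have [_ []] := h n I.
Qed.

End multiplicity.

(** * The 5r-covering lemma *)

Section vitali.
Context (R : realType) (T I : Type) (d : T -> T -> R).
Hypothesis dm : is_metric d.
Context (c : I -> T) (r : I -> R) (V : set I) (M : R).
Hypotheses (r0 : forall i, V i -> 0 < r i) (rM : forall i, V i -> r i <= M).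

Let meet i j := dball d (c i) (r i) `&` dball d (c j) (r j) !=set0.

(* The last clause makes every index meeting the family meet a member of at least
   half its radius, hence lie in the 5-fold enlargement of that member. *)
Let disjoint_family (D : set I) := [/\ D `<=` V,
  forall i j, D i -> D j -> i <> j -> ~ meet i j &
  forall i, V i -> (exists2 j, D j & meet i j) ->
    exists j, [/\ D j, meet i j & r i <= 2 * r j]].

Lemma vitali_disjoint_cover : exists D : set I, [/\ D `<=` V,
  forall i j, D i -> D j -> i <> j ->
    dball d (c i) (r i) `&` dball d (c j) (r j) = set0 &
  forall i, V i -> exists2 j, D j & dball d (c i) (r i) `<=` dball d (c j) (5 * r j)].
Proof.
have [d0 dx dC dT] := dm.
(* Admissible families are stable under unions of chains, so Zorn's lemma gives a maximal one. *)
have [A [[AV Adis Ar] Amax]] : exists A, disjoint_family A /\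
    forall B, A `<` B -> ~ disjoint_family B.
  apply: Zorn_bigcup => F FP Ftot; split.
  - by move=> i [D /FP[DV _ _]]; exact: DV.
  - move=> i j [D FD Di] [E FE Ej] ij.
    have [DE|ED] := Ftot _ _ FD FE.
      by have [_ h _] := FP _ FE; apply: h => //; exact: DE.
    by have [_ h _] := FP _ FD; apply: h => //; exact: ED.
  - move=> i Vi [j [D FD Dj] ij]; have [_ _ h] := FP _ FD.
    have [|k [Dk ik rik]] := h i Vi; first by exists j.
    by exists k; split => //; exists D.
exists A; split => //.
  by move=> i j Ai Aj /(Adis i j Ai Aj) /set0P/negP; rewrite negbK => /eqP.
move=> i Vi.
suff /(Ar i Vi)[j [Aj [y [iy jy]] rij]] : exists2 j, A j & meet i j.
  exists j => // z; rewrite /dball /= => iz.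
  move: iy jy; rewrite /dball /= => iy jy.
  have := dT (c j) y z; have := dT y (c i) z; rewrite (dC y (c i)); lra.
(* Otherwise some indices meet no member of [A]. Adding one whose radius exceeds half the supremum
   of their radii keeps the family admissible, against maximality. *)
apply: contrapT => Ni.
pose N := [set i | V i /\ ~ exists2 j, A j & meet i j].
have sN : has_sup [set r i | i in N].
  split; first by exists (r i), i.
  by exists M => _ [k [Vk _] <-]; exact: rM.
set S := sup [set r i | i in N] in sN.
have rS k : N k -> r k <= S by move=> Nk; apply: ub_le_sup; [exact: sN.2|exists k].
have S0 : 0 < S by apply: lt_le_trans (r0 Vi) (rS i _).
have [|_ [i0 [Vi0 nAi0] <-]] := @sup_adherent R [set r i | i in N] (S / 2) _ sN.
  by lra.
rewrite -/S => Si0.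
apply: (Amax (A `|` [set i0])).
  split; first by move=> k; left.
  move=> /(_ i0 (or_intror erefl)) Ai0; apply: nAi0; exists i0 => //.
  by exists (c i0); split; rewrite /dball /= (dx _ _).2 ?r0.
have meetC a b : meet a b -> meet b a by move=> [y [? ?]]; exists y.
split.
- by move=> k [/AV//|->].
- move=> a b [Aa|->] [Ab|->] ab //; first exact: Adis.
    by move=> ab'; apply: nAi0; exists a => //; exact: meetC.
  by move=> ab'; apply: nAi0; exists b.
- move=> k Vk [j Aj kj].
  have [kA|kA] := pselect (exists2 j, A j & meet k j).
    by have [j' [Aj' kj' rk]] := Ar k Vk kA; exists j'; split => //; left.
  exists i0; split; first by right.
    by case: Aj => [Aj|<-//]; exfalso; apply: kA; exists j.
  have := rS k (conj Vk kA); lra.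
Qed.

(** Each disjoint ball contains a dense point, so label [m] with the ball containing [q m], if any.
    [fresh] keeps only the first occurrence of a label, so that no ball is listed twice. *)
Lemma vitali_countable_cover (q : nat -> T) : ddense d q ->
  exists pk : nat -> option I, [/\ forall m i, pk m = Some i -> V i,
  forall m n i j, pk m = Some i -> pk n = Some j -> m <> n ->
    dball d (c i) (r i) `&` dball d (c j) (r j) = set0 &
  forall i, V i -> exists m j, pk m = Some j /\
    dball d (c i) (r i) `<=` dball d (c j) (5 * r j)].
Proof.
have [d0 dx dC dT] := dm; move=> qd.
have [D [DV Ddis Dcov]] := vitali_disjoint_cover.
have /choice[pk pkP] : forall m, exists oi : option I,
    (forall i, oi = Some i -> D i /\ dball d (c i) (r i) (q m)) /\
    (oi = None -> forall i, D i -> ~ dball d (c i) (r i) (q m)).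
  move=> m; have [[i [Di im]]|h] := pselect (exists i, D i /\ dball d (c i) (r i) (q m)).
    by exists (Some i); split => // _ [<-].
  by exists None; split => // _ i Di im; apply: h; exists i.
pose fresh m := `[< forall n, (n < m)%N -> pk n = pk m -> False >].
exists (fun m => if fresh m then pk m else None); split.
- move=> m i; case: ifP => // _ omi; apply: DV.
  by have [] := (pkP m).1 i omi.
- move=> m n i j; case: ifP => // /asboolP fm; case: ifP => // /asboolP fn om on mn.
  have [Di _] := (pkP m).1 i om; have [Dj _] := (pkP n).1 j on.
  have [ij|] := pselect (i = j); last exact: Ddis.
  have omn : pk m = pk n by rewrite om on ij.
  move: mn => /eqP; rewrite neq_ltn => /orP[mn|nm]; first by case: (fn m mn omn).
  by case: (fm n nm (esym omn)).
- move=> i Vi; have [j Dj ij] := Dcov i Vi.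
  have [m qm] := qd (c j) (r j) (r0 (DV _ Dj)); rewrite dC in qm.
  have omj : pk m = Some j.
    have [h1 h2] := pkP m; case: (pk m) h1 h2 => [k|] h1 h2.
      have [Dk km] := h1 k erefl; congr Some; apply: contrapT => kj.
      by have := Ddis _ _ Dk Dj kj; apply/eqP/set0P; exists (q m).
    by have := h2 erefl j Dj qm.
  have ex : exists n, pk n == Some j :> {classic option I}.
    by exists m; exact/eqP.
  exists (ex_minn ex), j; case: ex_minnP => n /eqP onj nmin; split => //.
  case: ifP => // /asboolP; case => k kn ok.
  by have := nmin k; rewrite ok onj eqxx leqNgt kn => /(_ isT).
Qed.

End vitali.

(** * Colliding points *)

Section colliding.
Context (R : realType) (X Y : Type) (d : X -> X -> R) (rho : Y -> Y -> R) (s L : R).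
Context (f : X -> Y).
Hypotheses (dm : is_metric d) (cd : complete_metric d) (rm : is_metric rho).
Hypotheses (s0 : 0 < s) (L0 : 0 < L) (fL : forall x y, rho (f x) (f y) <= L * d x y).
Hypothesis XT : (hausdorff d s setT < +oo)%E.

Local Notation HX := (hausdorff_outer d s0).
Local Notation HY := (hausdorff_outer rho s0).

Definition colliding (kappa : R) (x : X) (r : R) := exists x' : X, d x x' = 2 * r /\
  (kappa%:E * (r `^ s)%:E <= hausdorff rho s (f @` dball d x r `&` f @` dball d x' r))%E.

Lemma hausdorff_open_caratheodory O : dopen d O -> HX.-caratheodory O.
Proof. by apply: caratheodory_open => // A B; exact: hausdorff_separated. Qed.

(** A common image point has preimages [u], [v] in two disjoint balls, so [u] and [v] differ, are at
    most [4 * r] apart, and lie within [3 * r] of [x]. Either one of them is outside [K], or the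
    point is in [close_fiber]; the accumulating fibres are null. *)
Lemma colliding_image (K : set X) (N : nat) (x x' : X) (r : R) :
  0 < r -> d x x' = 2 * r -> 4 * r <= N.+1%:R^-1 -> HY (accumulating_fiber d f K) = 0%E ->
  (HY (f @` dball d x r `&` f @` dball d x' r) <= (L `^ s)%:E *
    (HX (K `&` f @^-1` (close_fiber d f K N `\` accumulating_fiber d f K) `&` dball d x (3 * r))
     + HX (~` K `&` dball d x (3 * r))))%E.
Proof.
have [d0 dx dC dT] := dm; move=> r0 xx' rN acc0.
set T := K `&` _; set D := dball d x (3 * r).
have Ls0 : (0 <= (L `^ s)%:E)%E by rewrite lee_fin powR_ge0.
rewrite ge0_muleDr; [|exact: outer_measure_ge0|exact: outer_measure_ge0].
apply: (@le_trans _ _ (HY (f @` (T `&` D) `|` f @` (~` K `&` D) `|`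
    accumulating_fiber d f K))).
  apply: le_outer_measure => y [[u xu fu] [v xv fv]].
  move: xu xv; rewrite /dball /= => xu xv.
  have Du : D u by rewrite /D /dball /=; lra.
  have Dv : D v by rewrite /D /dball /=; have := dT x x' v; lra.
  have [Ku|nKu] := pselect (K u); last by left; right; exists u.
  have [Kv|nKv] := pselect (K v); last by left; right; exists v.
  have [?|nacc] := pselect (accumulating_fiber d f K y); first by right.
  left; left; exists u => //; split => //; split => //; split; rewrite /= fu//.
  exists u, v; split => //; apply/andP; split; last first.
    apply: le_trans rN; have := dT u x v; have := dT x x' v; rewrite (dC u x); lra.
  rewrite lt_neqAle d0 andbT eq_sym; apply/eqP => /dx uv.
  by have := dT x v x'; rewrite (dC v x') xx'; move: xu; rewrite uv; lra.
apply: (le_trans (outer_measureU2 _ _ _)); rewrite acc0 adde0.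
apply: (le_trans (outer_measureU2 _ _ _)).
by apply: leeD; exact: hausdorff_image.
Qed.

Lemma colliding_null (kappa : R) (B : set X) : 0 < kappa ->
  (forall x, B x -> forall n : nat, exists r, 0 < r <= n.+1%:R^-1 /\ colliding kappa x r) ->
  hausdorff d s B = 0%E.
Proof.
have [d0 dx dC dT] := dm.
move=> k0 Bcol.
have [/eqP ->|/set0P[x0 _]] := boolP (B == set0); first by rewrite hausdorff0.
have [q qd] := hausdorff_separable x0 dm XT.
have [U [UF Uoo]] := exists_ultrafilter_nat.
have Ls0 : 0 < L `^ s by rewrite powR_gt0.
(* The enlarged balls have radius [5 * (3 * r)], hence diameter at most [30 * r]. The factor
   [L ^ s / kappa] comes from comparing the collision bound with [colliding_image]. *)
pose C := 30 `^ s / kappa * L `^ s.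
have C0 : 0 < C by rewrite mulr_gt0// divr_gt0// powR_gt0.
apply/eqP; rewrite eq_le hausdorff_ge0 andbT.
apply/lee_addgt0Pr => e e0; rewrite add0e.
pose e' := e / C / 2.
have e'0 : 0 < e' by rewrite !divr_gt0.
have mO := hausdorff_open_caratheodory.
have [K cK nK] := outer_measure_tight (mu := HX) dm cd mO XT UF Uoo qd e'0.
have Yf A : (HY (f @` A) <= (L `^ s)%:E * HX A)%E by exact: hausdorff_image.
have acc0 := accumulating_fiber_null dm rm L0 fL mO XT Ls0 Yf UF Uoo qd cK.
have [N TN] := close_fiber_small dm rm L0 fL mO XT UF Uoo cK e'0.
set T := K `&` _ in TN.
apply: hausdorff_le => delta delta0.
(* The first bound gives [4 * r <= 1/(N+1)], as [colliding_image] requires; the second keeps the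
   enlarged balls within mesh [delta]. *)
have [|n nN] := @exists_invS_lt R (Num.min (N.+1%:R^-1 / 4) (delta / 30)).
  by rewrite lt_min !divr_gt0// invr_gt0.
move: nN; rewrite lt_min => /andP[nN nd].
have /choice[r rP] : forall x, exists r, B x -> 0 < r <= n.+1%:R^-1 /\ colliding kappa x r.
  move=> x; have [Bx|nBx] := pselect (B x); last by exists 0.
  by have [r rP] := Bcol x Bx n; exists r.
have r0 x : B x -> 0 < r x by move=> /rP[/andP[]].
have rn x : B x -> r x <= n.+1%:R^-1 by move=> /rP[/andP[]].
(* Radius [3 * r] is the one in which [colliding_image] locates the charged measure; disjointness
   prevents charging it twice. *)
have [||pk [pkB pkdis pkcov]] := @vitali_countable_cover R X X d dm id (fun x => 3 * r x) B
    (3 * n.+1%:R^-1) _ _ q qd.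
- by move=> x /r0; lra.
- by move=> x /rn; rewrite ler_pM2l.
pose F m := if pk m is Some x then dball d x (15 * r x) else set0.
pose D m := if pk m is Some x then dball d x (3 * r x) else set0.
have oD m : HX.-caratheodory (D m).
  apply: hausdorff_open_caratheodory => x; rewrite /D; case: (pk m) => [y|//].
  rewrite /dball /= => xy; exists (3 * r y - d y x); split; first by rewrite subr_gt0.
  by move=> z; rewrite /dball /= => xz; have := dT y x z; lra.
have tD : trivIset setT D.
  move=> a b _ _ [x []]; rewrite /D.
  case ea: (pk a) => [y|//]; case eb: (pk b) => [z|//] yx zx.
  apply: contrapT => ab; have := pkdis _ _ _ _ ea eb ab.
  by apply/eqP/set0P; exists x.
have FD m : ((hcost d s (F m))%:E <= C%:E * (HX (T `&` D m) + HX (~` K `&` D m)))%E.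
  rewrite /F /D; case em: (pk m) => [x|]; last first.
    rewrite hcost0// mule_ge0 ?lee_fin ?(ltW C0)// adde_ge0//; exact: outer_measure_ge0.
  have Bx := pkB _ _ em; have [/andP[rx0 rxn] [x' [xx' col]]] := rP x Bx.
  apply: (@le_trans _ _ ((30 * r x) `^ s)%:E).
    rewrite lee_fin; apply: hcost_le => //; first by lra.
    move=> u v; rewrite /dball /= => xu xv.
    by have := dT u x v; rewrite (dC u x); lra.
  rewrite powRM//; last exact: ltW.
  have := le_trans col (colliding_image (K := K) (N := N) rx0 xx' _ acc0).
  rewrite -/T => /(_ _)/wrap[|h].
    by move: (N.+1%:R^-1) (n.+1%:R^-1) nN rxn => a b; lra.
  rewrite /C -(mulrA _ kappa^-1) !EFinM -!muleA.
  apply: lee_wpmul2l; first by rewrite lee_fin powR_ge0.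
  by rewrite lee_pdivlMl.
apply: (@le_trans _ _ (\sum_(0 <= m <oo) (hcost d s (F m))%:E)%E).
  apply: ereal_inf_lbound; exists F => //; split.
    move=> x Bx; have [m [j [mj sub]]] := pkcov x Bx; exists m => //.
    rewrite /F mj (_ : 15 * r j = 5 * (3 * r j)); last by lra.
    by apply: sub; rewrite /dball /= (dx _ _).2// mulr_gt0// r0.
  move=> m; rewrite /F; case em: (pk m) => [x|]; last by rewrite diam0 leNye.
  have Bx := pkB _ _ em; apply/diam_leP => u v; rewrite /dball /= => xu xv.
  have := rn x Bx; have := dT u x v; rewrite (dC u x).
  by move: (n.+1%:R^-1) nd => a; lra.
apply: (@le_trans _ _ (\sum_(0 <= m <oo) C%:E * (HX (T `&` D m) + HX (~` K `&` D m)))%E).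
  by apply: lee_nneseries => // i _ _; rewrite lee_fin hcost_ge0.
rewrite nneseriesZl; last first.
  by move=> i _; apply: adde_ge0; exact: outer_measure_ge0.
rewrite nneseriesD; try by move=> i _ _; exact: outer_measure_ge0.
(* Over the disjoint balls the two charges sum to at most the measures of [T] and of the complement
   of [K]. *)
apply: (@le_trans _ _ (C%:E * (e'%:E + e'%:E))%E).
  apply: lee_wpmul2l; first by rewrite lee_fin ltW.
  by apply: leeD; [apply: le_trans TN|apply: le_trans nK]; exact: caratheodory_series_le.
rewrite -EFinD -EFinM lee_fin /e'.
by rewrite -splitr mulrC divfK// gt_eqF.
Qed.

End colliding.

(** * Density sets and bi-Lipschitz pieces *)

Lemma limsup0_lt (R : realType) (g : R -> \bar R) (a : \bar R) : (limsup0 g < a)%E ->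
  exists e, 0 < e /\ forall r, 0 < r < e -> (g r < a)%E.
Proof.
move=> /ereal_inf_lt[_ [e /= e0 <-] ea]; exists e; split => // r re.
by apply: le_lt_trans ea; apply: ereal_sup_ubound; exists r.
Qed.

Lemma liminf0_gt (R : realType) (g : R -> \bar R) (a : \bar R) : (a < liminf0 g)%E ->
  exists e, 0 < e /\ forall r, 0 < r < e -> (a < g r)%E.
Proof.
move=> /ereal_sup_gt[_ [e /= e0 <-] ea]; exists e; split => // r re.
by apply: lt_le_trans ea _; apply: ereal_inf_lbound; exists r.
Qed.

Lemma limsup0_ge0 (R : realType) (g : R -> \bar R) : (forall r : R, 0 < r -> (0 <= g r)%E) ->
  (0 <= limsup0 g)%E.
Proof.
move=> g0; apply: le_ereal_inf_tmp => _ [e /= e0 <-].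
have e2 : 0 < e / 2 < e by lra.
apply: le_trans (ereal_sup_ubound _); last by exists (e / 2).
by apply: g0; have /andP[] := e2.
Qed.

Lemma ereal_lt_two_reals (R : realType) (x y : \bar R) : (0 <= x < y)%E ->
  exists a b : R, [/\ (x < a%:E)%E, a < b & (b%:E < y)%E].
Proof.
move=> /andP[x0 xy]; have xfin : x \is a fin_num by rewrite ge0_fin_numE// (lt_le_trans xy)// leey.
rewrite -(fineK xfin) in xy *; move: (fine x) xy => {x0 xfin}x.
case: y => [y||]; last by rewrite ltNge leNye.
  rewrite lte_fin => xy; exists (x + (y - x) / 3), (x + (y - x) / 3 * 2).
  by split; rewrite ?lte_fin; lra.
by move=> _; exists (x + 1), (x + 2); split; rewrite ?lte_fin ?ltry//; lra.
Qed.

Section bilipschitz_closure.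
Context (R : realType) (X Y : Type) (d : X -> X -> R) (rho : Y -> Y -> R) (L : R).
Context (f : X -> Y).
Hypotheses (dm : is_metric d) (rm : is_metric rho).
Hypotheses (L0 : 0 < L) (fL : forall x y, rho (f x) (f y) <= L * d x y).

Lemma dopen_dborelC (C : set X) : dopen d C -> dborel d (~` C).
Proof. by move=> oC; rewrite -setTD; apply: sigma_algebraCD; exact: sub_sigma_algebra. Qed.

(** The lower bound passes to the closure by continuity of [f], and the closure is Borel even when
    [P] is not. *)
Lemma bilipschitz_closure (P : set X) (M : R) : 0 <= M ->
  (forall x y, P x -> P y -> d x y <= M * rho (f x) (f y)) ->
  exists C, [/\ P `<=` C, dborel d C & bilipschitz_on d rho f C].
Proof.
have [d0 dx dC dT] := dm; have [e0 ex eC eT] := rm => M0 PM.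
pose C := [set x | forall e, 0 < e -> exists2 y, P y & d x y < e].
have CM x y : C x -> C y -> d x y <= M * rho (f x) (f y).
  move=> Cx Cy; apply/ler_addgt0Pr => e e1.
  have ML0 : 0 < 1 + M * L by rewrite ltr_wpDr// mulr_ge0// ltW.
  (* Moving both points by [h] costs [2 * h] in [X] and [2 * (M * L * h)] through [f], in total
     [e]. *)
  pose h := e / (2 * (1 + M * L)).
  have h0 : 0 < h by rewrite divr_gt0// mulr_gt0.
  have [x' Px' xx'] := Cx h h0; have [y' Py' yy'] := Cy h h0.
  have := PM _ _ Px' Py'.
  have H1 : rho (f x') (f y') <= rho (f x) (f y) + 2 * (L * h).
    have fx : rho (f x') (f x) <= L * h.
      by apply: (le_trans (fL _ _)); rewrite ler_pM2l// dC ltW.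
    have fy : rho (f y) (f y') <= L * h.
      by apply: (le_trans (fL _ _)); rewrite ler_pM2l// ltW.
    have := eT (f x') (f x) (f y'); have := eT (f x) (f y) (f y'); lra.
  have H2 : M * rho (f x') (f y') <= M * rho (f x) (f y) + 2 * (M * L * h).
    by apply: (le_trans (ler_wpM2l M0 H1)); rewrite mulrDr; lra.
  have H3 : 2 * h + 2 * (M * L * h) = e by rewrite /h; field; rewrite gt_eqF.
  have := dT x x' y; have := dT x' y' y; rewrite (dC y' y); lra.
exists C; split.
- by move=> x Px e e1; exists x => //; rewrite (dx _ _).2.
- rewrite -(setCK C); apply: dopen_dborelC => x Cx.
  have [e [e1 eP]] : exists e, 0 < e /\ forall y, P y -> e <= d x y.
    apply: contrapT => h; apply: Cx => e e1; apply: contrapT => h'.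
    apply: h; exists e; split => // y Py; rewrite leNgt; apply/negP => xy.
    by apply: h'; exists y.
  have e20 : 0 < e / 2 by lra.
  exists (e / 2); split => // z; rewrite /dball /= => xz Cz.
  have [y Py zy] := Cz _ e20.
  by have := eP y Py; have := dT x z y; lra.
- split.
    move=> x y /set_mem Cx /set_mem Cy fxy; apply/dx/eqP.
    rewrite eq_le d0 andbT; apply: (le_trans (CM _ _ Cx Cy)).
    by rewrite (ex _ _).2// mulr0.
  exists (M + L); split; first by rewrite addr_ge0// ltW.
  move=> x y Cx Cy; split.
    by apply: (le_trans (fL _ _)); apply: ler_wpM2r => //; rewrite lerDr.
  by apply: (le_trans (CM _ _ Cx Cy)); apply: ler_wpM2r => //; rewrite lerDl ltW.
Qed.

End bilipschitz_closure.

Lemma outer_measure_null_bigcup (R : realType) (T : Type) (J : countType)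
  (mu : {outer_measure set T -> \bar R}) (B : J -> set T) :
  (forall j, mu (B j) = 0%E) -> mu (\bigcup_j B j) = 0%E.
Proof.
move=> B0; apply/eqP; rewrite eq_le outer_measure_ge0 andbT.
pose B' n := if unpickle n is Some j then B j else set0.
apply: (@le_trans _ _ (mu (\bigcup_n B' n))).
  apply: le_outer_measure => x [j _ Bx]; exists (pickle j) => //.
  by rewrite /B' pickleK.
apply: (le_trans (outer_measure_sigma_subadditive mu _)).
rewrite eseries0// => n _ _; rewrite /B'.
by case: (unpickle n) => [j|]; rewrite ?B0// outer_measure0.
Qed.

Section density_sets.
Context (R : realType) (X Y : Type) (d : X -> X -> R) (rho : Y -> Y -> R) (s : R).
Context (f : X -> Y).
Hypotheses (dm : is_metric d) (rm : is_metric rho) (s0 : 0 < s).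

Definition covering_set (lam mu alpha beta : R) (e : nat) : set X := [set x |
  forall r, 0 < r < e.+1%:R^-1 ->
  (hausdorff rho s (dball rho (f x) (lam * r) `\` f @` dball d x r) <= (alpha * r `^ s)%:E)%E /\
  ((beta * r `^ s)%:E <= hausdorff rho s (dball rho (f x) (mu * r)))%E].

(** The ball of radius [mu * r] around [f x] lies in the balls of radius [lam * r] around [f x] and
    [f x']. Its mass is at least [beta * r ^ s] and each image misses at most [alpha * r ^ s] of it;
    the rest lies in both images. *)
Lemma covering_set_colliding lam mu alpha beta e x x' r : mu < lam ->
  covering_set lam mu alpha beta e x -> covering_set lam mu alpha beta e x' ->
  0 < r < e.+1%:R^-1 -> d x x' = 2 * r -> rho (f x) (f x') <= (lam - mu) * r ->
  colliding d rho s f (beta - 2 * alpha) x r.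
Proof.
have [e0 ex eC eT] := rm => ml Ax Ax' r0 xx' fxx'; exists x'; split => //.
have /andP[r1 _] := r0.
have [cx bx] := Ax r r0; have [cx' _] := Ax' r r0.
rewrite -EFinM mulrBl EFinB leeBlDl//.
apply: (le_trans bx); rewrite -mulrA mulr2n mulrDl !mul1r EFinD.
rewrite -(hausdorff_outerE _ s0); set A := dball rho (f x) _ `\` _ in cx.
set B := dball rho (f x') _ `\` _ in cx'; set I' := _ `&` _.
apply: (@le_trans _ _ (hausdorff_outer rho s0 (A `|` B `|` I'))).
  apply: le_outer_measure => y; rewrite /dball /= => xy.
  have mlr : mu * r < lam * r by rewrite ltr_pM2r.
  have [fx|fx] := pselect ((f @` dball d x r) y); last first.
    by left; left; split => //; rewrite /dball /=; apply: lt_trans mlr.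
  have [fx'|fx'] := pselect ((f @` dball d x' r) y); first by right.
  left; right; split => //; rewrite /dball /=.
  by have := eT (f x') (f x) y; rewrite (eC (f x') (f x)); lra.
apply: (le_trans (outer_measureU2 _ _ _)); apply: leeD => //.
by apply: (le_trans (outer_measureU2 _ _ _)); apply: leeD.
Qed.

(* [alpha] and [beta] absorb the factors [(2 lam)^s] and [(2 mu)^s]; shrinking [lam]
   slightly to [mu] and perturbing makes all parameters rational. *)
Lemma covering_set_exists x lam : 0 < lam <= 1 ->
  (limsup0 (fun r => hausdorff rho s
       (dball rho (f x) (lam * r) `\` f @` dball d x r) * ((2 * lam * r) `^ s)^-1%:E)
    < (2^-1)%:E * lower_density rho s setT (f x))%E ->
  exists (l m a b : rat) (e : nat), [/\ (ratr m : R) < ratr l, 2 * (ratr a : R) < ratr b &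
    covering_set (ratr l) (ratr m) (ratr a) (ratr b) e x].
Proof.
move=> /andP[l0 l1] h.
move: h; set g := (fun r => _) => h.
have g0 : (0 <= limsup0 g)%E.
  apply: limsup0_ge0 => r r0; apply: mule_ge0; first exact: hausdorff_ge0.
  by rewrite lee_fin invr_ge0 powR_ge0.
have [|a [b [ga ab]]] := ereal_lt_two_reals (x := limsup0 g)
  (y := ((2^-1)%:E * lower_density rho s setT (f x))%E); first by rewrite g0 h.
have a0 : 0 < a by rewrite -lte_fin; exact: le_lt_trans g0 ga.
have b0 : 0 < b by apply: lt_trans ab.
rewrite lte_pdivlMl// -EFinM => /liminf0_gt[e2 [e20 H2]].
have [e1 [e10 H1]] := limsup0_lt ga.
(* Shrinking the radius by [t] multiplies its power [s] by [w]. Since [w] lies strictly between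
   [a / b] and 1, the strict inequality survives as [a < b * w]. *)
pose w := (1 + a / b) / 2.
have ab1 : a / b < 1 by rewrite ltr_pdivrMr// mul1r.
have ab0 : 0 < a / b by rewrite divr_gt0.
have w01 : 0 < w < 1 by rewrite /w; lra.
have /andP[w0 w1] := w01.
pose t := w `^ s^-1.
have ts : t `^ s = w by rewrite /t -powRrM mulVf ?gt_eqF// powRr1// ltW.
have t0 : 0 < t by rewrite powR_gt0.
have t1 : t < 1.
  rewrite ltNge; apply/negP => t1.
  have := ge0_ler_powR (ltW s0) _ _ t1; rewrite !nnegrE ler01 (ltW t0) powR1 ts => /(_ isT isT).
  by rewrite leNgt w1.
pose m0 := lam * t.
have m00 : 0 < m0 by rewrite mulr_gt0.
have m0l : m0 < lam by rewrite gtr_pMr.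
pose al := a * (2 * lam) `^ s; pose be := 2 * b * (2 * m0) `^ s.
have [l0' t0'] := (ltW l0, ltW t0).
have albe : 2 * al < be.
  rewrite /al /be /m0 (mulrA 2 lam) (powRM _ _ (ltW t0)) ?mulr_ge0 ?(ltW l0)// ts.
  rewrite -!mulrA ltr_pM2l// mulrCA [ltRHS]mulrCA mulrC [ltRHS]mulrC.
  rewrite -mulrA ltr_pM2l ?powR_gt0 ?mulr_gt0// /w.
  by rewrite (_ : _ * b = (b + a) / 2); [lra|field; rewrite gt_eqF].
(* The rational choices only weaken the bounds: [m0 < m < l < lam] shrinks the outer ball and
   enlarges the inner one, while [al < a'], [b' < be] and still [2 * a' < b']. *)
have [m /[!in_itv]/= /andP[m0m ml]] := rat_in_itvoo m0l.
have [l /[!in_itv]/= /andP[ml' ll]] := rat_in_itvoo ml.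
have [b' /[!in_itv]/= /andP[ab' b'b]] := rat_in_itvoo albe.
have [|a' /[!in_itv]/= /andP[aa' a'b']] := @rat_in_itvoo R al (ratr b' / 2).
  by lra.
have [|e] := @exists_invS_lt R (Num.min e1 e2); first by rewrite lt_min e10.
rewrite lt_min => /andP[ee1 ee2].
exists l, m, a', b', e; split => //; first by lra.
move=> r /andP[r0 re].
have rs0 : 0 < r `^ s by rewrite powR_gt0.
split.
  apply: (@le_trans _ _ (al * r `^ s)%:E); last by rewrite lee_fin ler_pM2r// ltW.
  rewrite /al -mulrA -powRM ?mulr_ge0 ?(ltW l0) ?(ltW r0)// EFinM.
  rewrite -lee_pdivrMr ?powR_gt0 ?mulr_gt0//.
  have /H1/ltW : 0 < r < e1 by rewrite r0 (lt_trans re).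
  apply: le_trans; apply: lee_wpmul2r; first by rewrite lee_fin invr_ge0 powR_ge0.
  apply: le_hausdorff => y [ly ny]; split => //.
  by apply: (lt_trans ly); rewrite ltr_pM2r.
apply: (@le_trans _ _ (be * r `^ s)%:E); first by rewrite lee_fin ler_pM2r// ltW.
have /H2/ltW : 0 < m0 * r < e2.
  rewrite mulr_gt0//=; apply: le_lt_trans (lt_trans re ee2).
  by apply: ler_piMl; [exact: ltW|apply: ltW; apply: (lt_le_trans m0l)].
rewrite setIT lee_pdivlMr ?powR_gt0 ?mulr_gt0// => bH.
rewrite /be -mulrA -powRM ?mulr_ge0 ?(ltW m00) ?(ltW r0)//.
rewrite EFinM -(mulrA 2 m0); apply: (le_trans bH).
by apply: le_hausdorff => y ly; apply: (lt_trans ly); rewrite ltr_pM2r.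
Qed.

End density_sets.

(** * Assembly of the Borel decomposition *)

Lemma bilipschitz_decomposition (R : realType) (X Y : Type) (d : X -> X -> R)
  (rho : Y -> Y -> R) (s L : R) (f : X -> Y) (I : countType) (P : I -> set X) (N0 : set X) :
  is_metric d -> is_metric rho -> 0 < s ->
  0 < L -> (forall x y, rho (f x) (f y) <= L * d x y) ->
  (forall i, exists2 M, 0 <= M &
    forall x y, P i x -> P i y -> d x y <= M * rho (f x) (f y)) ->
  setT `<=` N0 `|` \bigcup_i P i -> hausdorff d s N0 = 0%E ->
  exists (N : set X) (Xi : nat -> set X),
    [/\ dborel d N, (forall i, dborel d (Xi i)),
        setT = N `|` \bigcup_i Xi i, hausdorff d s N = 0%E &
        forall i, bilipschitz_on d rho f (Xi i)].
Proof.
move=> dm rm s0 L0 fL PM XP N00.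
have /choice[C CP] : forall i, exists C, [/\ P i `<=` C, dborel d C & bilipschitz_on d rho f C].
  by move=> i; have [M M0 h] := PM i; exact: (bilipschitz_closure dm rm L0 fL M0 h).
pose Xi m := if unpickle m is Some i then C i else set0.
have XiB i : dborel d (Xi i).
  rewrite /Xi; case: (unpickle i) => [j|]; first by have [] := CP j.
  by apply: sub_sigma_algebra => x.
(* The complement of the Borel pieces is Borel, and null because it is contained in [N0]. *)
exists (~` \bigcup_i Xi i), Xi; split => //.
- rewrite -setTD; apply: sigma_algebraCD; exact: sigma_algebra_bigcup.
- by rewrite setUC setUv.
- apply/eqP; rewrite eq_le hausdorff_ge0 andbT -N00; apply: le_hausdorff => x nx.
  have [//|[i _ Px]] := XP x Logic.I.
  exfalso; apply: nx; exists (pickle i) => //; rewrite /Xi pickleK.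
  by have [h _ _] := CP i; exact: h.
- move=> i; rewrite /Xi; case: (unpickle i) => [j|]; first by have [] := CP j.
  by split; [move=> x y /set_mem|exists 0; split => // x y []].
Qed.

Theorem mainTheorem1 (R : realType) (X Y : Type) (d : X -> X -> R) (rho : Y -> Y -> R)
  (s : R) (f : X -> Y) :
  is_metric d -> complete_metric d ->
  is_metric rho -> complete_metric rho ->
  0 < s ->
  lipschitz_map d rho f ->
  (hausdorff d s setT < +oo)%E ->
  (exists N0 : set X, hausdorff d s N0 = 0%E /\
     forall x : X, ~ N0 x ->
       exists lam : R, 0 < lam <= 1 /\
         (limsup0 (fun r => hausdorff rho s
                     (dball rho (f x) (lam * r) `\` f @` dball d x r)
                   * ((2 * lam * r) `^ s)^-1%:E)
          < (2^-1)%:E * lower_density rho s setT (f x))%E) ->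
  exists (N : set X) (Xi : nat -> set X),
    [/\ dborel d N, (forall i, dborel d (Xi i)),
        setT = N `|` \bigcup_i Xi i,
        hausdorff d s N = 0%E &
        forall i, bilipschitz_on d rho f (Xi i)].
Proof.
move=> dm cd rm _ s0 [L' [L'0 fL']] XT [N0 [N00 dens]].
have [d0 dx dC dT] := dm; have [e0 ex eC eT] := rm.
(* A positive constant, so that scales can be divided by it. *)
pose L := L' + 1; have L0 : 0 < L by rewrite ltr_wpDl.
have fL x y : rho (f x) (f y) <= L * d x y.
  by apply: (le_trans (fL' x y)); rewrite ler_wpM2r// lerDl.
have [[x0 _]|X0] := pselect ([set: X] !=set0); last first.
  apply: (@bilipschitz_decomposition _ _ _ d rho s L f unit (fun=> set0) set0) => //.
  - by move=> i; exists 0.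
  - by move=> x _; exfalso; apply: X0; exists x.
  - exact: hausdorff0.
have [q qd] := hausdorff_separable x0 dm XT.
pose J := (rat * rat * rat * rat * nat)%type.
pose valid (p : J) := let: (l, m, a, b, e) := p in
  (ratr m : R) < ratr l /\ 2 * (ratr a : R) < ratr b.
pose A (p : J) : set X := let: (l, m, a, b, e) := p in
  covering_set d rho s f (ratr l) (ratr m) (ratr a) (ratr b) e.
pose gap (p : J) : R := let: (l, m, _, _, _) := p in ratr l - ratr m.
(* Failure of this local bound at distance [2 * r] means that the images are closer than
   [gap p * r], as [covering_set_colliding] requires. *)
pose G (p : J) (n : nat) : set X := [set x | A p x /\ forall x', A p x' ->
  d x x' < n.+1%:R^-1 -> d x x' <= 2 / gap p * rho (f x) (f x')].
pose B (p : J) : set X := [set x | [/\ valid p, A p x & forall n, ~ G p n x]].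
have gap0 p : valid p -> 0 < gap p.
  by case: p => [[[[l m] a] b] e] [ml _]; rewrite /gap subr_gt0.
have B0 p : hausdorff d s (B p) = 0%E.
  have [vp|nvp] := pselect (valid p); last first.
    by rewrite (_ : B p = set0) ?hausdorff0//; apply/seteqP; split => // x [].
  have gp := gap0 p vp.
  case: p vp gp => [[[[l m] a] b] e] [ml ab] gp.
  apply: (@colliding_null _ _ _ d rho s L f dm cd rm s0 L0 fL XT (ratr b - 2 * ratr a)).
    by rewrite subr_gt0.
  (* [n] bounds the collision scale requested by [colliding_null], and [e] keeps it in the range
     where [A] gives its estimates. *)
  move=> x [_ Ax nG] n; have nGe := nG (maxn n e).
  have [x' [Ax' xx' fxx']] : exists x', [/\ A (l, m, a, b, e) x',
      d x x' < (maxn n e).+1%:R^-1 &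
      2 / gap (l, m, a, b, e) * rho (f x) (f x') < d x x'].
    apply: contrapT => h; apply: nGe; split => // x' Ax' xx'.
    by rewrite leNgt; apply/negP => fxx'; apply: h; exists x'.
  have small k : (k <= maxn n e)%N -> d x x' < k.+1%:R^-1.
    move=> kne; apply: (lt_le_trans xx').
    by rewrite lef_pV2 ?posrE// ler_nat ltnS.
  have dxx' : 0 < d x x'.
    by apply: le_lt_trans fxx'; rewrite mulr_ge0// divr_ge0// ltW.
  have half : d x x' / 2 <= d x x' by lra.
  exists (d x x' / 2); split.
    by rewrite divr_gt0//= (le_trans half)// ltW// small// leq_maxl.
  apply: (@covering_set_colliding _ _ _ d rho s f rm s0 (ratr l) (ratr m) _ _ e x x' _ ml Ax Ax').
  - by rewrite divr_gt0//= (le_lt_trans half)// small// leq_maxr.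
  - by rewrite mulrC divfK.
  - move: fxx'; rewrite mulrAC ltr_pdivrMr// => h.
    by move: h gp; rewrite /gap; lra.
(* Cutting with balls of radius [1/(n+1) / 2] brings any two points of a piece within [1/(n+1)],
   where the local bound of [G p n] applies. *)
pose P (i : J * nat * nat) : set X := let: (p, n, j) := i in
  [set x | [/\ valid p, G p n x & d (q j) x < n.+1%:R^-1 / 2]].
apply: (@bilipschitz_decomposition _ _ _ d rho s L f _ P (N0 `|` \bigcup_p B p)) => //.
- move=> [[p n] j]; have [vp|nvp] := pselect (valid p); last first.
    by exists 0 => // x y [].
  exists (2 / gap p); first by rewrite divr_ge0// ltW// gap0.
  move=> x y [_ [_ Gx] qx] [_ [Ay _] qy]; apply: Gx => //.
  apply: (le_lt_trans (dT x (q j) y)); rewrite (dC x).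
  by move: (n.+1%:R^-1) qx qy => c; lra.
- move=> x _; have [|nN] := pselect (N0 x); first by left; left.
  have [lam [lam01 dlam]] := dens x nN.
  have [l [m [a [b [e [ml ab Ax]]]]]] := covering_set_exists s0 lam01 dlam.
  have [[n Gx]|nG] := pselect (exists n, G (l, m, a, b, e) n x).
    right; have [|j qx] := qd x (n.+1%:R^-1 / 2); first by rewrite divr_gt0// invr_gt0.
    by exists (l, m, a, b, e, n, j).
  by left; right; exists (l, m, a, b, e) => //; split => // n Gx; apply: nG; exists n.
- apply/eqP; rewrite eq_le hausdorff_ge0 andbT -(hausdorff_outerE _ s0).
  apply: (le_trans (outer_measureU2 _ _ _)).
  have HB : hausdorff_outer d s0 (\bigcup_p B p) = 0%E by exact: outer_measure_null_bigcup.
  by rewrite HB hausdorff_outerE N00 adde0.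
Qed.
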